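(* Let $n\ge 1$ and let $D$ be a chord diagram of degree $n$ on components $1,\dots,n+1$, having a chord $c$ between components $k$ and $n+1$ (where $1\le k\le n$). Let $J$ be the set of chords of $D$ with at least one endpoint on the components $1,\dots,k-1$. Then $$M_{1;n+1}(D)=M_{1;k}(D_{J,\infty})\cdot M_{k+1;n+1}(D_{J,0}).$$ In particular, if $k=1$ then $M_{1;n+1}(D)=M_{2;n+1}(D_{J,0})$, and if $k=n$ then $M_{1;n+1}(D)=M_{1;n}(D_{J,\infty})$. Moreover, if $D_{ij}$ is the diagram with a single chord, connecting components $i$ and $j$, then $M_{i,j}(D_{ij})=1$.
   Context: Tangles. All tangles are oriented, without closed components: proper embeddings of finitely many disjoint oriented labelled intervals in the solid cylinder (disk)$\times[0,1]$, with endpoints lying along a line on the bottom and a line on the top, up to ambient isotopy fixing endpoints. String links (strand $i$ running from the $i$-th bottom point to the $i$-th top point) are a special case. Milnor invariants. Take a diagram of a tangle $L$. The fundamental group of the complement has a Wirtinger presentation with one generator per arc and, at each crossing of sign $\varepsilon=\pm1$ with over-arc $x$, incoming under-arc $y$ and outgoing under-arc $z$, the relation $z=x^{-\varepsilon}yx^{\varepsilon}$ (crossing signs conventionally normalized so). Let $m_i$ be the generator of the first arc of component $i$ and let $l_j$ be the product of the elements $x^{\varepsilon}$ over the undercrossings of component $j$, in the order met along $j$. Modulo a sufficiently deep term of the lower central series, $l_j$ is a word in the $m_i$; substitute $m_i\mapsto 1+K_i$, $m_i^{-1}\mapsto 1-K_i+K_i^2-\cdots$ (non-commuting $K_i$).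 For distinct $i_1,\dots,i_n,j$, $\mu_{i_1\cdots i_n,j}(L)$ is the coefficient of $K_{i_1}\cdots K_{i_n}$ in $l_j$. It is extended to singular tangles (finitely many double points) by $\mu(L_\times)=\mu(L_+)-\mu(L_-)$ (positive resolution minus negative resolution of a double point), and it vanishes on singular tangles with more than $n$ double points. Chord diagrams and weight systems. A chord diagram of degree $n$ is a tangle's collection of oriented labelled intervals (components) together with $n$ chords whose $2n$ endpoints are distinct points on the components; it is determined by the orders of the endpoints on each component. A singular tangle represents the diagram if its double points correspond to the chords (each chord's endpoints being identified). $M_{i_1\cdots i_n,j}(D)=\mu_{i_1\cdots i_n,j}(S(D))$ for any singular tangle $S(D)$ representing the degree $n$ diagram $D$; this is independent of the choice. Notation: $M_{p;q}=M_{p,p+1,\dots,q-1,q}$, i.e. the weight system of $\mu_{p\,(p+1)\cdots(q-1),\,q}$ (the last index is the longitude index). Conventions for the recursion. $M_{p;q}$ is taken to be $0$ on diagrams whose degree is not $q-p$ and on diagrams with a chord endpoint on a component with label outside $\{p,\dots,q\}$; $M_{q;q}$ of a diagram with no chords is $1$. The split diagrams. Let $c$ join components $k$ and $n+1$. - $D_{J,\infty}$: replace components $k$ and $n+1$ by one new component labelled $k$, which follows the old component $n+1$ along its orientation from its start to the endpoint of $c$, and then follows the old component $k$ from the endpoint of $c$ against its orientation back to its start. Keep only the chords in $J$. The parts of components $k$ and $n+1$ after $c$ are erased. Since part of component $k$ is traversed backwards, the diagram carries a factor $-1$ for each chord endpoint lying on that reversed part (antisymmetry relation): $M_{1;k}(D_{J,\infty})$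 means $(-1)^{s}$ times $M_{1;k}$ of the underlying oriented chord diagram, $s$ being the number of chord endpoints on the reversed part. - $D_{J,0}$: replace components $k$ and $n+1$ by one new component labelled $n+1$, which follows the old component $k$ from its start to the endpoint of $c$ and then the old component $n+1$ from the endpoint of $c$ to its end, respecting both orientations. Keep only the chords of $D$ other than $c$ that are not in $J$. The part of component $k$ after $c$ and the part of component $n+1$ before $c$ are erased. If any chord of $D_{J,\infty}$ (respectively $D_{J,0}$) has an endpoint on an erased part, then the corresponding factor is defined to be $0$. *)

(* Defs.v *)
From mathcomp Require Import all_boot all_algebra.
From Stdlib Require Import ClassicalEpsilon.

Set Implicit Arguments.
Unset Strict Implicit.
Unset Printing Implicit Defensive.

Import GRing.Theory.

Local Open Scope ring_scope.
Local Open Scope nat_scope.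

(** * Chord diagrams *)

(* Chords are named by natural numbers; [cd_code D i] lists the chords met
   along the component labelled [i], in the order of its orientation (it is
   only meaningful for [i] in [cd_labels D]). *)
Record chord_diagram := ChordDiagram {
  cd_labels : seq nat;
  cd_chords : seq nat;
  cd_code : nat -> seq nat }.

(* The last clause: each chord has exactly two endpoints on the components. *)
Definition cd_wf (D : chord_diagram) : bool :=
  [&& uniq (cd_labels D), uniq (cd_chords D)
    & perm_eq (flatten [seq cd_code D i | i <- cd_labels D])
              (cd_chords D ++ cd_chords D)].

Definition cd_degree (D : chord_diagram) : nat := size (cd_chords D).

(** * Tangle diagrams, possibly with double points *)

(* Signed Gauss codes of tangle diagrams drawn in a rectangle.
   - [td_strand L i] lists the passes through crossings along the component
     labelled [i]: [(x, true)] is the over-pass at [x], [(x, false)] the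
     under-pass.
   - [td_pos L x] holds if the crossing [x] is positive.
   - At a double point (an element of [td_double L]), over and under refer to
     the positive resolution, and [td_pos] is irrelevant.
   - [td_bot] and [td_top] list, from left to right, the endpoints on the bottom
     and on the top line: [(i, false)] is the start of the component [i], and
     [(i, true)] is its end. *)
Record tangle_diagram := TangleDiagram {
  td_ncross : nat;
  td_double : {set 'I_td_ncross};
  td_pos : 'I_td_ncross -> bool;
  td_labels : seq nat;
  td_strand : nat -> seq ('I_td_ncross * bool);
  td_bot : seq (seq_sub td_labels * bool);
  td_top : seq (seq_sub td_labels * bool) }.

Arguments td_pos : clear implicits.

Section Planarity.
Variable L : tangle_diagram.

Local Notation endpoint := (seq_sub (td_labels L) * bool)%type.

(* Half-edges of the underlying planar graph, whose vertices are the crossings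
   and one vertex at infinity to which the exterior of the rectangle is
   collapsed. At a crossing, [(x, b, o)] is the incoming ([o = false]) or
   outgoing ([o = true]) half-edge of the pass [(x, b)]. An endpoint is a
   half-edge at infinity. *)
Local Notation dart := ('I_(td_ncross L) * bool * bool + endpoint)%type.

(* All the half-edges, in the order in which they are met when running through
   the components one after the other: the two halves of an edge occupy
   positions [2 * m] and [2 * m + 1]. *)
Definition dart_seq : seq dart :=
  flatten [seq inr (i, false) ::
    rcons (flatten [seq [:: inl (p, false); inl (p, true)]
                        | p <- td_strand L (ssval i)])
          (inr (i, true)) | i <- enum {: seq_sub (td_labels L)}].

Definition edge_mate (d : dart) : dart :=
  let m := index d dart_seq in nth d dart_seq (if odd m then m.-1 else m.+1).

(* The next half-edge counterclockwise around the same vertex. Around a positive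
   crossing the order is over-out, under-out, over-in, under-in; around a
   negative one it is under-out, over-out, under-in, over-in. The
   counterclockwise order around the vertex at infinity is clockwise along the
   boundary of the rectangle. *)
Definition rotate (d : dart) : dart :=
  match d with
  | inl (x, b, o) =>
      let pos := (x \in td_double L) || td_pos L x in
      inl (x, ~~ b, if b == pos then o else ~~ o)
  | inr e => inr (prev (td_bot L ++ rev (td_top L)) e)
  end.

(* The regions of the rectangle are the cycles of [rotate \o edge_mate], except
   that when there is no component the only region has no half-edge. The graph
   is connected since all components are intervals, so that the equation is
   Euler's formula: it holds exactly when the Gauss code comes from a drawing in
   the rectangle. *)
Definition td_planar : bool :=
  fcard (rotate \o edge_mate) {: dart} + nilp (td_labels L)
    == td_ncross L + size (td_labels L) + 1.

Definition is_tangle : bool :=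
  [&& uniq (td_labels L),
      perm_eq (flatten [seq td_strand L i | i <- td_labels L])
              (enum {: 'I_(td_ncross L) * bool}),
      perm_eq (td_bot L ++ td_top L) (enum {: endpoint})
    & td_planar].

End Planarity.

(* The double points in [A] are resolved negatively and the others positively;
   the two resolutions of a double point differ by the sign of the crossing and
   by the exchange of the over- and under-strands. *)
Definition resolve (L : tangle_diagram) (A : {set 'I_(td_ncross L)}) :
    tangle_diagram :=
  @TangleDiagram (td_ncross L) set0
    (fun x => if x \in td_double L then x \notin A else td_pos L x)
    (td_labels L)
    (fun i => [seq (p.1, p.2 (+) (p.1 \in td_double L :&: A))
                   | p <- td_strand L i])
    (td_bot L) (td_top L).

(** * Milnor invariants of a tangle diagram without double points *)

Section Wirtinger.
Variable L : tangle_diagram.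

Local Notation pass := ('I_(td_ncross L) * bool)%type.

(* [(i, t)] is the arc of the component [i] that follows its [t]-th
   undercrossing, so that [(i, 0)] is its first arc. *)
Definition arc : Type := (nat * nat)%type.

(* Words in the generators: [(a, true)] is [a] and [(a, false)] its inverse. *)
Definition word : Type := seq (arc * bool).

Definition winv (w : word) : word := rev [seq (l.1, ~~ l.2) | l <- w].

Definition nunder (s : seq pass) : nat := count (fun p => ~~ p.2) s.

Definition is_arc (a : arc) : bool :=
  (a.1 \in td_labels L) && (a.2 <= nunder (td_strand L a.1)).

Definition is_word (w : word) : bool := all (fun l => is_arc l.1) w.

Definition over_arc (x : 'I_(td_ncross L)) : arc :=
  let i := nth 0 (td_labels L)
             (find (fun i => (x, true) \in td_strand L i) (td_labels L)) in
  (i, nunder (take (index (x, true) (td_strand L i)) (td_strand L i))).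

(* Equality in the group presented by the arcs and the Wirtinger relations
   z = x^-e y x^e. *)
Inductive group_eq : word -> word -> Prop :=
| group_eq_refl w : group_eq w w
| group_eq_sym u v : group_eq u v -> group_eq v u
| group_eq_trans u v w : group_eq u v -> group_eq v w -> group_eq u w
| group_eq_cancel u v a e :
    is_arc a -> group_eq (u ++ [:: (a, e); (a, ~~ e)] ++ v) (u ++ v)
| group_eq_wirtinger u v i s1 s2 (x : 'I_(td_ncross L)) :
    i \in td_labels L -> td_strand L i = s1 ++ (x, false) :: s2 ->
    group_eq (u ++ [:: ((i, (nunder s1).+1), true)] ++ v)
             (u ++ [:: (over_arc x, ~~ td_pos L x);
                       ((i, nunder s1), true);
                       (over_arc x, td_pos L x)] ++ v).

(* The lower central series; the whole group is its term of index 1. *)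
Inductive lower_central : nat -> word -> Prop :=
| lower_central_top w : is_word w -> lower_central 1 w
| lower_central_comm q u v : lower_central q u -> is_word v ->
    lower_central q.+1 (winv u ++ winv v ++ u ++ v)
| lower_central_mul q u v :
    lower_central q u -> lower_central q v -> lower_central q (u ++ v)
| lower_central_inv q u : lower_central q u -> lower_central q (winv u)
| lower_central_eq q u v :
    group_eq u v -> lower_central q u -> lower_central q v.

Definition longitude (j : nat) : word :=
  [seq (over_arc p.1, td_pos L p.1) | p <- td_strand L j & ~~ p.2].

End Wirtinger.

(* A power series with integer coefficients in the non-commuting variables
   [K_i], as the function giving the coefficient of each monomial. *)
Definition series : Type := seq nat -> int.

Definition series_one : series := fun s => (s == [::])%:R%R.

Definition series_mul (f g : series) : series :=
  fun s => (\sum_(0 <= m < (size s).+1) f (take m s) * g (drop m s))%R.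

(* [1 + K_i] if [e], and [1 - K_i + K_i^2 - ...] otherwise. *)
Definition magnus_gen (i : nat) (e : bool) : series :=
  fun s => if e then ((s == [::]) || (s == [:: i]))%:R%R
           else if s == nseq (size s) i then ((-1) ^+ size s)%R else 0%R.

(* Here [(i, e)] stands for the meridian [m_i] or its inverse. *)
Definition magnus (w : seq (nat * bool)) : series :=
  foldr (fun l f => series_mul (magnus_gen l.1 l.2) f) series_one w.

Definition meridian_word (w : seq (nat * bool)) : word :=
  [seq ((l.1, 0), l.2) | l <- w].

(* The coefficient of a monomial of degree [d] in the expansion of a word only
   depends on its class modulo the terms of index [q > d] of the lower central
   series. *)
Definition is_milnor (L : tangle_diagram) (I : seq nat) (j : nat) (v : int) :
    Prop :=
  exists q w, [/\ size I < q, all (fun l => l.1 \in td_labels L) w,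
    lower_central L q (winv (meridian_word w) ++ longitude L j)
    & v = magnus w I].

Definition milnor (L : tangle_diagram) (I : seq nat) (j : nat) : int :=
  epsilon (inhabits 0%R) (is_milnor L I j).

(* The full expansion of mu(L_x) = mu(L_+) - mu(L_-) over all double points. *)
Definition milnor_singular (L : tangle_diagram) (I : seq nat) (j : nat) : int :=
  (\sum_(A in powerset (td_double L)) (-1) ^+ #|A| * milnor (resolve A) I j)%R.

(** * Weight systems *)

(* [f] is the correspondence between double points and chords. *)
Definition represents (L : tangle_diagram) (D : chord_diagram) : Prop :=
  is_tangle L /\ perm_eq (td_labels L) (cd_labels D) /\
  exists f : 'I_(td_ncross L) -> nat,
    perm_eq [seq f x | x <- enum (td_double L)] (cd_chords D) /\
    {in cd_labels D, forall i,
      [seq f p.1 | p <- td_strand L i & p.1 \in td_double L] = cd_code D i}.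

(* A choice of a singular tangle representing each chord diagram. *)
Definition representatives (S : chord_diagram -> tangle_diagram) : Prop :=
  forall D, cd_wf D -> represents (S D) D.

Section Weight.
Variable S : chord_diagram -> tangle_diagram.

(* M_{I,j}, for diagrams of degree [size I]. *)
Definition weight (I : seq nat) (j : nat) (D : chord_diagram) : int :=
  milnor_singular (S D) I j.

Definition supported (p q : nat) (D : chord_diagram) : bool :=
  all (fun i => (cd_code D i != [::]) ==> (p <= i <= q)) (cd_labels D).

(* M_{p;q}, for [p <= q]. *)
Definition interval_weight (p q : nat) (D : chord_diagram) : int :=
  if (p + cd_degree D == q) && supported p q D then
    if p == q then 1%R else weight (iota p (q - p)) q D
  else 0%R.

End Weight.

(** * Splitting a diagram along a chord *)

Definition before (c : nat) (s : seq nat) : seq nat := take (index c s) s.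
Definition after (c : nat) (s : seq nat) : seq nat := drop (index c s).+1 s.

(* In this section [c] is a chord between the components [k] and [N]. *)
Section Split.
Variables (S : chord_diagram -> tangle_diagram) (D : chord_diagram).
Variables (c k N : nat).

Definition chords_J : seq nat :=
  [seq x <- cd_chords D | has (fun i => x \in cd_code D i) (iota 1 k.-1)].

Definition chords_notJ : seq nat :=
  [seq x <- cd_chords D | (x != c) && (x \notin chords_J)].

Definition split_inf : chord_diagram :=
  ChordDiagram [seq i <- cd_labels D | i != N] chords_J
    (fun i => [seq x <- if i == k then
                          before c (cd_code D N) ++ rev (before c (cd_code D k))
                        else cd_code D i | x \in chords_J]).

Definition split_zero : chord_diagram :=
  ChordDiagram [seq i <- cd_labels D | i != k] chords_notJ
    (fun i => [seq x <- if i == N then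
                          before c (cd_code D k) ++ after c (cd_code D N)
                        else cd_code D i | x \in chords_notJ]).

(* M_{1;k} of [split_inf], including the sign of the reversed part. *)
Definition factor_inf : int :=
  if has (mem chords_J) (after c (cd_code D k) ++ after c (cd_code D N))
  then 0%R
  else ((-1) ^+ count (mem chords_J) (before c (cd_code D k))
        * interval_weight S 1 k split_inf)%R.

(* M_{k+1;N} of [split_zero]. *)
Definition factor_zero : int :=
  if has (mem chords_notJ) (after c (cd_code D k) ++ before c (cd_code D N))
  then 0%R
  else interval_weight S k.+1 N split_zero.

End Split.

(* Main.v *)
Require Import Defs.
From mathcomp Require Import all_boot all_algebra zify.
From Stdlib Require Import ClassicalEpsilon.

(** Fix distinct labels [I = i_1 ... i_n]. Sending the variable of a label to
    the sum of the elementary matrices at its positions in [I] turns a power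
    series into a triangular integer matrix whose entry [(a, b)] is the
    coefficient of the subword of [I] from position [a] to position [b]. This
    kills the monomials in which a variable repeats, so the arc of component [i]
    reached after the undercrossings [w] becomes [1 + E(w)^-1 K_i E(w)], where
    [E(w)] is the product of the arcs passing over, and the system of these
    equations is solved by recursion on the length of words ([expansion]). The
    Wirtinger relations then hold exactly, because on an interval each of them
    only defines the next arc from the previous ones, and the term of index [q]
    of the lower central series acts trivially on words of fewer than [q]
    letters ([lower_central_mx]). With Milnor's algorithm, which writes the
    longitudes as words in the meridians, this identifies a Milnor invariant
    with one entry of [E(longitude)] ([milnor_expansion]).

    That entry is a polynomial in the signs of the crossings, of degree the
    length of the word, since every letter is brought by one crossing
    ([graded_expansion]). Resolving [n] double points in all ways takes a
    difference of order [n] of a polynomial of degree [n]: only the monomials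
    that use every double point once survive, ordinary crossings disappear, and
    it does not matter which strand of a double point is said to pass over. So a
    weight is the difference, over variables attached to the chords, of an
    expansion computed on the chord diagram, where a chord endpoint counts as an
    undercrossing under the component of the other endpoint
    ([weight_difference]).

    Now let [P c Q] be the chords met along component [n+1] and [R] those met
    along component [k] before [c]. The part of the expansion of component [n+1]
    that contains the variable [y_c] is [y_c E(P) E(R)^-1 K_k E(R) E(Q)], so its
    coefficient at [K_1 ... K_n] is [y_c] times the coefficient of [K_1 ...
    K_(k-1)] in [E(P) E(R)^-1] and that of [K_(k+1) ... K_n] in [E(R) E(Q)]
    ([chord_expansion_split]). The first one only involves the chords in [J] and
    is, up to the signs coming from the inverse, the expansion of the joined
    component of [D_(J,infty)]; the second one only involves the chords outside
    [J] and is that of [D_(J,0)]. The difference therefore factors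
    ([difference_split]), and degree counting settles the cases where the
    numbers of chords do not match the degrees. *)

Set Implicit Arguments.
Unset Strict Implicit.
Unset Printing Implicit Defensive.

Import GRing.Theory.

Local Open Scope ring_scope.

(** * Triangular matrices reading off the coefficients of subwords of I *)

Section Triangular.
Variable I : seq nat.

Local Notation mx := 'M[int]_((size I).+1).

Implicit Types (X Y Z : mx) (P : rel nat) (o : option nat).
Implicit Types (a b : 'I_((size I).+1)).

(** Entry [(a, b)] of a matrix stands for the coefficient of the subword of [I]
    from position [a] to position [b], and the variable of label [i] becomes the
    sum of the elementary matrices [(a, a.+1)] over the positions [a] of [i]. *)
Definition letter_mx o : mx :=
  \matrix_(a, b) ((b == a.+1 :> nat) && (onth I a == o))%:R.

Definition subword (s t : nat) : seq nat := take (t - s) (drop s I).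

Definition order_ge (d : nat) X := forall a b, (b < a + d)%N -> X a b = 0.

Lemma order_geD d X Y : order_ge d X -> order_ge d Y -> order_ge d (X + Y).
Proof. by move=> hX hY a b lt; rewrite mxE hX ?hY ?addr0. Qed.

Lemma order_geN d X : order_ge d X -> order_ge d (- X).
Proof. by move=> hX a b lt; rewrite mxE hX ?oppr0. Qed.

Lemma order_geZ d c X : order_ge d X -> order_ge d (c *: X).
Proof. by move=> hX a b lt; rewrite mxE hX ?mulr0. Qed.

Lemma order_geW d d' X : (d' <= d)%N -> order_ge d X -> order_ge d' X.
Proof. by move=> le hX a b lt; apply: hX; lia. Qed.

Lemma order_geM d d' X Y :
  order_ge d X -> order_ge d' Y -> order_ge (d + d') (X * Y).
Proof.
move=> hX hY a b lt; rewrite -mulmxE mxE big1 // => r _.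
have [ltr|ler] := ltnP r (a + d); first by rewrite hX ?mul0r.
by rewrite (hY r b) ?mulr0 //; lia.
Qed.

Lemma order_geMl d X Y : order_ge 0 X -> order_ge d Y -> order_ge d (X * Y).
Proof. exact: order_geM. Qed.

Lemma order_geMr d X Y : order_ge d X -> order_ge 0 Y -> order_ge d (X * Y).
Proof. by rewrite -{2}[d]addn0; exact: order_geM. Qed.

Lemma order_ge1 : order_ge 0 1.
Proof. by move=> a b lt; rewrite mxE; case: eqP => // e; rewrite e in lt;
  lia. Qed.

Lemma order_ge_letter o : order_ge 1 (letter_mx o).
Proof. by move=> a b lt; rewrite mxE; case: eqP => // e; lia. Qed.

Lemma order_ge_large X : order_ge (size I).+1 X -> X = 0.
Proof.
by move=> h; apply/matrixP => a b; rewrite mxE h //; have := ltn_ord b; lia.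
Qed.

Lemma order_ge_subM d X X' Y Y' : order_ge 0 X' -> order_ge 0 Y ->
  order_ge d (X - X') -> order_ge d (Y - Y') -> order_ge d (X * Y - X' * Y').
Proof.
move=> hX' hY hX hY'; have -> : X * Y - X' * Y' = (X - X') * Y + X' * (Y - Y').
  by rewrite mulrBl mulrBr addrA subrK.
by apply: order_geD; [apply: order_geMr | apply: order_geMl].
Qed.

(** Without repetition in [I], no subword contains the same label twice. *)
Lemma letter_mx_sandwich o X :
  uniq I -> order_ge 0 X -> letter_mx o * X * letter_mx o = 0.
Proof.
move=> uI hX; apply/matrixP => a b; rewrite -!mulmxE mxE [RHS]mxE big1 // => r _.
rewrite mxE big_distrl big1 //= => s _; rewrite !mxE.
case: (s =P a.+1 :> nat) => [es|]; last by rewrite !mul0r.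
case: (onth I a =P o) => [ea|]; last by rewrite !mul0r.
case: (b =P r.+1 :> nat) => [eb|]; last by rewrite mulr0.
case: (onth I r =P o) => [er|]; last by rewrite mulr0.
rewrite (hX s r) ?mulr0 ?mul0r // addn0 es ltnS.
suff -> : r = a :> nat by [].
have rI : (r < size I)%N by have := ltn_ord b; rewrite eb.
by apply: (@onth_inj _ I r a uI); rewrite ?gtn_min ?rI ?orbT ?er ?ea.
Qed.

(** The sets of entries on which a product is determined by the same entries of
    its factors. *)
Definition interval_closed P :=
  forall a r b : nat, P a b -> (a <= r)%N -> (r <= b)%N -> P a r && P r b.

Definition window (s t : nat) : rel nat :=
  fun a b : nat => (s <= a)%N && (b <= t)%N.

Lemma window_closed s t : interval_closed (window s t).
Proof. by move=> a r b; rewrite /window; lia. Qed.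

Definition agree P X Y :=
  [/\ order_ge 0 X, order_ge 0 Y & forall a b, P a b -> X a b = Y a b].

Lemma agree_refl P X : order_ge 0 X -> agree P X X.
Proof. by []. Qed.

Lemma agree_sym P X Y : agree P X Y -> agree P Y X.
Proof. by case=> h1 h2 h3; split=> // a b /h3. Qed.

Lemma agree_trans P X Y Z : agree P X Y -> agree P Y Z -> agree P X Z.
Proof. by case=> h1 h2 h3 [_ h5 h6]; split=> // a b p; rewrite h3 ?h6. Qed.

Lemma agreeD P X X' Y Y' :
  agree P X X' -> agree P Y Y' -> agree P (X + Y) (X' + Y').
Proof.
case=> h1 h2 h3 [h4 h5 h6]; split; try exact: order_geD.
by move=> a b p; rewrite !mxE h3 ?h6.
Qed.

Lemma agreeZ P c X X' : agree P X X' -> agree P (c *: X) (c *: X').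
Proof.
case=> h1 h2 h3; split; try exact: order_geZ.
by move=> a b p; rewrite !mxE h3.
Qed.

Lemma agreeM P X X' Y Y' : interval_closed P ->
  agree P X X' -> agree P Y Y' -> agree P (X * Y) (X' * Y').
Proof.
move=> cP [h1 h2 h3] [h4 h5 h6]; split; try exact: order_geMl.
move=> a b p; rewrite -!mulmxE !mxE; apply: eq_bigr => r _.
have [ltr|ler] := ltnP r a; first by rewrite h1 ?h2 ?mul0r //; lia.
have [ltb|leb] := ltnP b r; first by rewrite (h4 r b) ?(h5 r b) ?mulr0 //; lia.
by case/andP: (cP a r b p ler leb) => p1 p2; rewrite h3 ?h6.
Qed.

Lemma agree_prod0 P X Y Z : interval_closed P ->
  order_ge 0 X -> order_ge 0 Z -> agree P Y 0 -> agree P (X * Y * Z) 0.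
Proof.
move=> cP hX hZ hY; have -> : 0 = X * 0 * Z by rewrite mulr0 mul0r.
by do 2![apply: agreeM => //].
Qed.

Lemma order_ge0_letter o : order_ge 0 (letter_mx o).
Proof. by apply: order_geW (order_ge_letter o). Qed.

Lemma order_ge00 d : order_ge d 0.
Proof. by move=> a b _; rewrite mxE. Qed.

Lemma onth_subword s t r : (s <= r)%N -> (r < t)%N ->
  onth (subword s t) (r - s) = onth I r.
Proof.
move=> le lt; rewrite !onthE /subword map_take map_drop nth_take ?nth_drop.
  by rewrite subnKC.
by lia.
Qed.

Lemma letter_mx_none : letter_mx None = 0.
Proof.
apply/matrixP => a b; rewrite !mxE; case: eqP => //= eb; case: eqP => //= ea.
have: ~~ onth I a by rewrite ea.
by rewrite onthNE; have := ltn_ord b; lia.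
Qed.

Lemma letter_mx_window s t o :
  (if o is Some i then i \notin subword s t else true) ->
  agree (window s t) (letter_mx o) 0.
Proof.
move=> ho; split; [exact: order_ge0_letter|exact: order_ge00|].
move=> a b /andP[sa bt]; rewrite !mxE; case: eqP => //= eb.
case: eqP => //= ea; exfalso; case: o ea ho => [i|] ea ho.
  by move/negP: ho; apply; apply/onthP; exists (a - s)%N;
    rewrite onth_subword ?eb //; lia.
have: ~~ onth I a by rewrite ea.
by rewrite onthNE; have := ltn_ord b; lia.
Qed.

End Triangular.

(** * Expansions of longitudes *)

Definition formal_inverse (H : Type) (w : seq (H * bool)) : seq (H * bool) :=
  rev [seq (l.1, ~~ l.2) | l <- w].

Definition positive_word (H : Type) (s : seq H) : seq (H * bool) :=
  [seq (h, true) | h <- s].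

Lemma formal_inverse_cat (H : Type) (u v : seq (H * bool)) :
  formal_inverse (u ++ v) = formal_inverse v ++ formal_inverse u.
Proof. by rewrite /formal_inverse map_cat rev_cat. Qed.

Lemma formal_inverseK (H : Type) : involutive (@formal_inverse H).
Proof.
move=> w; rewrite /formal_inverse map_rev revK -map_comp -[RHS]map_id.
by apply: eq_map => -[h b] /=; rewrite negbK.
Qed.

Section Expansion.
Variable I : seq nat.

Local Notation mx := 'M[int]_((size I).+1).

Section System.
(** A letter [h] is an undercrossing: [e h] is its sign, [cmp h] is the label of
    the component passing over, and [pre h] lists the undercrossings met on that
    component before the overpass. The arc passing over is thus the conjugate of
    the meridian of [cmp h] by the word [pre h]. *)
Variables (H : Type) (e : H -> int) (cmp : H -> option nat).
Variable pre : H -> seq (H * bool).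

(** Meridians expand to [1 + K], and the recursion through [pre] is cut at depth
    [q]: each level contributes at least one letter of [I]. *)
Fixpoint approx (q : nat) (w : seq (H * bool)) : mx :=
  if q is q'.+1 then
    \prod_(l <- w)
      (1 + (-1) ^+ (~~ l.2) *:
         (approx q' (formal_inverse (pre l.1))
          * (e l.1 *: letter_mx I (cmp l.1)) * approx q' (pre l.1)))
  else 1.

Definition expansion : seq (H * bool) -> mx := approx (size I).

Lemma approx_cat q u v : approx q (u ++ v) = approx q u * approx q v.
Proof. by case: q => [|q] /=; rewrite ?mulr1 // big_cat. Qed.

Lemma approx_nil q : approx q [::] = 1.
Proof. by case: q => //= q; rewrite big_nil. Qed.

Lemma approx_seq1 q l :
  approx q.+1 [:: l]
    = 1 + (-1) ^+ (~~ l.2) *: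
            (approx q (formal_inverse (pre l.1))
             * (e l.1 *: letter_mx I (cmp l.1)) * approx q (pre l.1)).
Proof. by rewrite /= big_seq1. Qed.

Lemma order_ge_approx q w : order_ge 0 (approx q w).
Proof.
elim: q w => [|q IH] w /=; first exact: order_ge1.
elim: w => [|l w IHw]; rewrite ?big_nil ?big_cons; first exact: order_ge1.
apply: order_geMl => //; apply: order_geD; first exact: order_ge1.
apply: order_geZ; apply: order_geMl => //; apply: order_geMl => //.
by apply: order_geZ; exact: order_ge0_letter.
Qed.

(** Going one level deeper in the recursion only changes longer words, because a
    level multiplies by one letter; the expansion is thus a fixed point. *)
Lemma order_ge_approx_step q w : order_ge q.+1 (approx q.+1 w - approx q w).
Proof.
elim: q w => [|q IH] w.
  elim: w => [|l w IHw] /=; first by rewrite big_nil subrr; apply: order_ge00.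
  rewrite big_cons -[X in _ - X]mulr1; apply: order_ge_subM.
  - exact: order_ge1.
  - exact: (order_ge_approx 1 w).
  - rewrite addrAC subrr add0r mul1r mulr1; do 2![apply: order_geZ].
    exact: order_ge_letter.
  - exact: IHw.
elim: w => [|l w IHw]; first by rewrite !approx_nil subrr; apply: order_ge00.
rewrite -cat1s 2!approx_cat; apply: order_ge_subM.
- exact: order_ge_approx.
- exact: order_ge_approx.
- rewrite !approx_seq1 opprD addrACA subrr add0r -scalerBr; apply: order_geZ.
  set K := e _ *: _.
  have oK : order_ge 1 K by apply: order_geZ; exact: order_ge_letter.
  have oK0 : order_ge 0 K by exact: order_geW oK.
  set X := approx q.+1 _; set X' := approx q _.
  set Y := approx q.+1 _; set Y' := approx q _.
  have oX : order_ge 0 X by exact: order_ge_approx.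
  have oX' : order_ge 0 X' by exact: order_ge_approx.
  have oY : order_ge 0 Y by exact: order_ge_approx.
  have -> : X * K * Y - X' * K * Y' = (X - X') * K * Y + X' * K * (Y - Y').
    by rewrite !mulrBl mulrBr addrA subrK.
  rewrite -[q.+2]addn1; apply: order_geD.
    apply: order_geMr => //; apply: order_geM => //; exact: IH.
  rewrite addnC; apply: order_geM; last exact: IH.
  exact: order_geMl.
- exact: IHw.
Qed.

Lemma expansion_cat u v : expansion (u ++ v) = expansion u * expansion v.
Proof. exact: approx_cat. Qed.

Lemma expansion_nil : expansion [::] = 1.
Proof. exact: approx_nil. Qed.

Lemma order_ge_expansion w : order_ge 0 (expansion w).
Proof. exact: order_ge_approx. Qed.

Definition conjugate_letter o w : mx :=
  expansion (formal_inverse w) * letter_mx I o * expansion w.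

Lemma expansion_seq1 h b :
  expansion [:: (h, b)]
    = 1 + ((-1) ^+ (~~ b) * e h) *: conjugate_letter (cmp h) (pre h).
Proof.
have : approx (size I).+1 [:: (h, b)] = approx (size I) [:: (h, b)].
  apply/eqP; rewrite -subr_eq0; apply/eqP.
  by apply: order_ge_large; apply: order_ge_approx_step.
rewrite /expansion => <-; rewrite /= big_seq1 /= -scalerA.
by rewrite -!scalerAr -!scalerAl.
Qed.

Lemma expansion_cons h b w :
  expansion ((h, b) :: w)
    = (1 + ((-1) ^+ (~~ b) * e h) *: conjugate_letter (cmp h) (pre h))
      * expansion w.
Proof. by rewrite -cat1s expansion_cat expansion_seq1. Qed.

Lemma order_ge_conjugate_letter o w : order_ge 1 (conjugate_letter o w).
Proof.
apply: order_geMr; last exact: order_ge_expansion.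
by apply: order_geMl; [exact: order_ge_expansion|exact: order_ge_letter].
Qed.

Lemma conjugate_letter_mul (uI : uniq I) o u v :
  conjugate_letter o u * conjugate_letter o v = 0.
Proof.
set K := letter_mx I o.
have -> : conjugate_letter o u * conjugate_letter o v
    = expansion (formal_inverse u)
      * (K * (expansion u * expansion (formal_inverse v)) * K) * expansion v.
  by rewrite !mulrA.
rewrite letter_mx_sandwich ?mulr0 ?mul0r //.
by apply: order_geMl; exact: order_ge_expansion.
Qed.

Lemma one_addZ_conjugate (uI : uniq I) c o w :
  (1 - c *: conjugate_letter o w) * (1 + c *: conjugate_letter o w) = 1.
Proof.
rewrite mulrDr mulr1 mulrBl mul1r -scalerAl -scalerAr conjugate_letter_mul //.
by rewrite !scaler0 subr0 subrK.
Qed.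

Lemma expansion_inverse (uI : uniq I) w :
  expansion (formal_inverse w) * expansion w = 1.
Proof.
elim: w => [|[h b] w IH]; first by rewrite expansion_nil mulr1.
rewrite -cat1s formal_inverse_cat !expansion_cat mulrA -(mulrA _ _ (expansion
  [:: _])).
rewrite !expansion_seq1; have -> : (-1) ^+ (~~ ~~ b) = - (-1) ^+ (~~ b) :> int.
  by case: b.
by rewrite mulNr scaleNr one_addZ_conjugate // mulr1.
Qed.

Lemma expansion_inverse_r (uI : uniq I) w :
  expansion w * expansion (formal_inverse w) = 1.
Proof. by rewrite -{1}[w]formal_inverseK expansion_inverse. Qed.

Lemma eq_conjugate_letter (uI : uniq I) o u v :
  expansion u = expansion v -> conjugate_letter o u = conjugate_letter o v.
Proof.
move=> euv; rewrite /conjugate_letter euv; congr (_ * _ * _).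
rewrite -[LHS]mulr1 -(expansion_inverse_r uI v) mulrA -euv.
by rewrite expansion_inverse // mul1r.
Qed.

End System.

(** The expansion of a word on a window only involves the crossings under the
    components labelled by that window. So two systems have the same expansion
    as soon as a relabelling [phi] of their letters, up to the signs [tau],
    respects the relevant ones; the letters called null contribute nothing. *)
Section Transport.
Variables (H H' : Type) (e : H -> int) (e' : H' -> int).
Variables (cmp : H -> option nat) (cmp' : H' -> option nat).
Variables (pre : H -> seq (H * bool)) (pre' : H' -> seq (H' * bool)).
Variables (P : rel nat) (phi : H -> option H') (tau : H -> bool).
Variable good : pred H.

Definition transport : seq (H * bool) -> seq (H' * bool) :=
  pmap (fun l => omap (fun h' => (h', l.2 (+) tau l.1)) (phi l.1)).

Definition null (G : Type) (f : G -> int) (d : G -> option nat) (h : G) :=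
  f h = 0 \/ agree P (letter_mx I (d h)) 0.

Definition matched (h : H) (h' : H') :=
  [/\ cmp h = cmp' h', e h = (-1) ^+ tau h * e' h',
      all good (unzip1 (pre h)) & pre' h' = transport (pre h)].

Lemma transport_cat u v : transport (u ++ v) = transport u ++ transport v.
Proof. exact: pmap_cat. Qed.

Lemma transport_inverse w :
  transport (formal_inverse w) = formal_inverse (transport w).
Proof.
elim: w => // -[h b] w IH; rewrite -(cat1s (h, b) w).
rewrite formal_inverse_cat !transport_cat formal_inverse_cat IH; congr (_ ++ _).
by rewrite /transport /=; case: (phi h) => //= h';
  rewrite /formal_inverse /= addNb.
Qed.

Lemma null_factor (G : Type) (f : G -> int) d q pr (h : G) (b : bool) :
  interval_closed P -> null f d h ->
  agree P (approx f d pr q [:: (h, b)]) 1.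
Proof.
move=> cP; case: q => [|q] nh /=; first exact: agree_refl (@order_ge1 I).
rewrite big_seq1 -[X in agree _ _ X]addr0; apply: agreeD.
  exact: agree_refl (@order_ge1 I).
rewrite -[X in agree _ _ X](scaler0 _ ((-1) ^+ ~~ b)); apply: agreeZ.
apply: agree_prod0 => //; try exact: order_ge_approx.
case: nh => /= [->|hd]; first by rewrite scale0r; apply: agree_refl;
  exact: order_ge00.
by rewrite -[X in agree _ _ X](scaler0 _ (f h)); apply: agreeZ.
Qed.

Lemma approx_transport (cP : interval_closed P) :
  (forall h, good h ->
    if phi h is Some h' then (null e cmp h /\ null e' cmp' h') \/ matched h h'
    else null e cmp h) ->
  forall q w, all good (unzip1 w) ->
    agree P (approx e cmp pre q w) (approx e' cmp' pre' q (transport w)).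
Proof.
move=> hphi; elim=> [|q IHq] w; first by move=> _;
  exact: agree_refl (@order_ge1 I).
elim: w => [|[h b] w IHw]; first by rewrite !approx_nil => _; apply: agree_refl;
  exact: order_ge1.
case/andP=> gh gw; rewrite -(cat1s (h, b) w) transport_cat !approx_cat.
apply: agreeM => //; last exact: IHw.
have -> : transport [:: (h, b)]
    = if phi h is Some h' then [:: (h', b (+) tau h)] else [::].
  by rewrite /transport /=; case: (phi h).
move: (hphi h gh); case: (phi h) => [h'|]; last first.
  by move=> nh; rewrite approx_nil; exact: null_factor.
case=> [[nh nh']|[ec ee gp ep]].
  apply: agree_trans (null_factor _ _ _ cP nh) _.
  exact/agree_sym/null_factor.
rewrite !approx_seq1 ep ec ee; apply: agreeD;
  first exact: agree_refl (@order_ge1 I).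
rewrite -!scalerAr -!scalerAl !scalerA mulrA -signr_addb -addNb /=.
apply: agreeZ; apply: agreeM => //; last exact: IHq.
apply: agreeM => //; last by apply: agree_refl; exact: order_ge0_letter.
rewrite -transport_inverse; apply: IHq.
by rewrite /formal_inverse /unzip1 map_rev all_rev -map_comp.
Qed.

Lemma expansion_transport (cP : interval_closed P) :
  (forall h, good h ->
    if phi h is Some h' then (null e cmp h /\ null e' cmp' h') \/ matched h h'
    else null e cmp h) ->
  forall w, all good (unzip1 w) ->
    agree P (expansion e cmp pre w) (expansion e' cmp' pre' (transport w)).
Proof. by move=> hphi w; apply: approx_transport. Qed.

End Transport.

End Expansion.

(** * Polynomial functions and their top differences *)

Section Polynomials.
Variable H : eqType.
Implicit Types (f g : (H -> int) -> int) (l : seq (int * seq H)) (y : H -> int).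

Definition monomial (s : seq H) y : int := \prod_(h <- s) y h.

Definition poly_eval l y : int := \sum_(c <- l) c.1 * monomial c.2 y.

Definition poly_le (d : nat) f :=
  exists2 l, all (fun c => size c.2 <= d)%N l & f =1 poly_eval l.

Lemma poly_le_ext d f g : f =1 g -> poly_le d f -> poly_le d g.
Proof. by move=> efg [l hl el]; exists l => // y; rewrite -efg. Qed.

Lemma poly_le_const d c : poly_le d (fun=> c).
Proof.
exists [:: (c, [::])] => //= y.
by rewrite /poly_eval /monomial big_seq1 big_nil mulr1.
Qed.

Lemma poly_le_var h : poly_le 1 (fun y => y h).
Proof.
by exists [:: (1, [:: h])] => // y; rewrite /poly_eval /monomial !big_seq1 mul1r.
Qed.

Lemma poly_leD d f g :
  poly_le d f -> poly_le d g -> poly_le d (fun y => f y + g y).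
Proof.
move=> [l hl el] [k hk ek]; exists (l ++ k); first by rewrite all_cat hl.
by move=> y; rewrite el ek /poly_eval big_cat.
Qed.

Lemma poly_leM d d' f g :
  poly_le d f -> poly_le d' g -> poly_le (d + d') (fun y => f y * g y).
Proof.
move=> [l hl el] [k hk ek].
exists [seq (a.1 * b.1, a.2 ++ b.2) | a <- l, b <- k].
  apply/allP => _ /allpairsP[[a b] [/(allP hl) /= ha /(allP hk) /= hb ->]] /=.
  by rewrite size_cat leq_add.
move=> y; rewrite el ek /poly_eval big_allpairs_dep big_distrl /=.
apply: eq_bigr => a _; rewrite big_distrr /=; apply: eq_bigr => b _.
by rewrite /monomial big_cat /= mulrACA.
Qed.

Lemma poly_le_sum d (J : Type) (r : seq J) (F : J -> (H -> int) -> int) :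
  (forall j, poly_le d (F j)) -> poly_le d (fun y => \sum_(j <- r) F j y).
Proof.
move=> hF; elim: r => [|j r IH].
  by apply: poly_le_ext (poly_le_const d 0) => y; rewrite big_nil.
by apply: poly_le_ext (poly_leD (hF j) IH) => y; rewrite big_cons.
Qed.

End Polynomials.

Section GradedExpansion.
Variables (I : seq nat) (H : eqType).

Local Notation mx := 'M[int]_((size I).+1).

Definition graded (F : (H -> int) -> mx) :=
  forall a b : 'I_((size I).+1),
    if (a <= b)%N then poly_le (b - a) (fun y => F y a b)
    else forall y, F y a b = 0.

Lemma graded_ext F G : F =1 G -> graded F -> graded G.
Proof.
move=> e hF a b; move: (hF a b); case: ifP => _ h; last by move=> y; rewrite -e.
by apply: poly_le_ext h => y; rewrite e.
Qed.

Lemma graded_const X : order_ge 0 X -> graded (fun=> X).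
Proof.
move=> hX a b; case: leqP => [_|lt]; first exact: poly_le_const.
by move=> _; rewrite hX // addn0.
Qed.

Lemma gradedD F G : graded F -> graded G -> graded (fun y => F y + G y).
Proof.
move=> hF hG a b; move: (hF a b) (hG a b); case: leqP => _ fF fG.
  by apply: poly_le_ext (poly_leD fF fG) => y; rewrite mxE.
by move=> y; rewrite mxE fF fG addr0.
Qed.

Lemma gradedM F G : graded F -> graded G -> graded (fun y => F y * G y).
Proof.
move=> hF hG a b; case: leqP => [le|lt]; last first.
  move=> y; rewrite -mulmxE mxE big1 // => r _.
  have [ler|ltr] := leqP a r; last by have := hF a r;
    rewrite leqNgt ltr /= => ->; rewrite mul0r.
  by have := hG r b; rewrite leqNgt (leq_trans lt ler) /= => ->; rewrite mulr0.
suff h : poly_le (b - a) (fun y => \sum_r F y a r * G y r b).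
  by apply: poly_le_ext h => y; rewrite -mulmxE mxE.
apply: poly_le_sum => r.
have [ler|ltr] := leqP a r; last first.
  apply: poly_le_ext (poly_le_const _ _ 0) => y.
  by have := hF a r; rewrite leqNgt ltr /= => ->; rewrite mul0r.
have [leb|ltb] := leqP r b; last first.
  apply: poly_le_ext (poly_le_const _ _ 0) => y.
  by have := hG r b; rewrite leqNgt ltb /= => ->; rewrite mulr0.
have -> : (b - a = (r - a) + (b - r))%N by lia.
by apply: poly_leM; [have := hF a r; rewrite ler|have := hG r b; rewrite leb].
Qed.

Lemma graded_letter h o : graded (fun y => y h *: letter_mx I o).
Proof.
move=> a b; case: leqP => [le|lt]; last first.
  by move=> y; rewrite mxE (order_ge0_letter o) ?mulr0 // addn0.
have [ltb|lea] := ltnP b (a + 1).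
  apply: poly_le_ext (poly_le_const _ _ 0) => y.
  by rewrite mxE (order_ge_letter o) ?mulr0.
have [->|ne] := eqVneq (b : nat) a.+1.
  rewrite subSnn; apply: poly_le_ext (poly_leM (poly_le_var h) (poly_le_const H
    0 (letter_mx I o a b))).
  by move=> y; rewrite [RHS]mxE.
apply: poly_le_ext (poly_le_const _ _ 0) => y.
by rewrite !mxE (negPf ne) mulr0.
Qed.

(** Every letter of a subword comes from one crossing. *)
Lemma graded_expansion cmp pre w :
  graded (fun y => expansion I y cmp pre w).
Proof.
suff: forall q, graded (fun y => approx I y cmp pre q w) by apply.
move=> q; elim: q w => [|q IHq] w.
  by apply: graded_const; exact: order_ge1.
elim: w => [|[h b] w IHw].
  by apply: graded_ext (graded_const (@order_ge1 I)) => y; rewrite approx_nil.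
pose X y := approx I y cmp pre q (formal_inverse (pre h)).
pose Y y := approx I y cmp pre q (pre h).
pose F y := 1 + ((-1) ^+ (~~ b))%:M * (X y * (y h *: letter_mx I (cmp h)) * Y y).
apply: (@graded_ext (fun y => F y * approx I y cmp pre q.+1 w)) => [y|].
  by rewrite -(cat1s (h, b) w) approx_cat approx_seq1 /F -mulmxE mul_scalar_mx.
apply: gradedM => //.
apply: gradedD; first exact/graded_const/order_ge1.
apply: gradedM.
  apply: graded_const => i j lt; rewrite mxE; case: eqP => // e.
  by move: lt; rewrite e addn0 ltnn.
apply: gradedM; last exact: IHq.
by apply: gradedM; [exact: IHq|exact: graded_letter].
Qed.

End GradedExpansion.

(** * Differences over all the chords *)

Section Differences.
Variable C : eqType.
Implicit Types (f g : (C -> int) -> int) (cs : seq C) (y : C -> int) (p : pred C).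

Definition update y x (v : int) : C -> int := fun z => if z == x then v else y z.

(** In the variables [cs], the alternating sum of [f] over the vertices of the
    unit cube. *)
Fixpoint difference cs f y : int :=
  if cs is x :: cs' then
    difference cs' f (update y x 1) - difference cs' f (update y x 0)
  else f y.

Definition depends_on p f :=
  forall y y', (forall z, p z -> y z = y' z) -> f y = f y'.

Lemma depends_onW p q f : subpred p q -> depends_on p f -> depends_on q f.
Proof. by move=> pq hf y y' e; apply: hf => z /pq; apply: e. Qed.

Lemma eq_difference cs f g y :
  (forall y', (forall z, z \notin cs -> y' z = y z) -> f y' = g y') ->
  difference cs f y = difference cs g y.
Proof.
elim: cs y => [|x cs IH] y e /=; first exact: e.
congr (_ - _); apply: IH => y' e'; apply: e => z;
  rewrite inE negb_or => /andP[nz ncs].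
  by rewrite e' // /update (negPf nz).
by rewrite e' // /update (negPf nz).
Qed.

Lemma differenceD cs f g y :
  difference cs (fun y => f y + g y) y = difference cs f y + difference cs g y.
Proof. by elim: cs y => //= x cs IH y; rewrite !IH opprD addrACA. Qed.

Lemma differenceZ cs c f y :
  difference cs (fun y => c * f y) y = c * difference cs f y.
Proof. by elim: cs y => //= x cs IH y; rewrite !IH mulrBr. Qed.

Lemma difference0 cs y : difference cs (fun=> 0) y = 0.
Proof. by elim: cs y => //= x cs IH y; rewrite !IH subr0. Qed.

Lemma difference_sum cs (J : Type) (r : seq J) (F : J -> (C -> int) -> int) y :
  difference cs (fun y => \sum_(j <- r) F j y) y
    = \sum_(j <- r) difference cs (F j) y.
Proof.
elim: r => [|j r IH].
  rewrite big_nil -[RHS](difference0 cs y).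
  by apply: eq_difference => y' _; rewrite big_nil.
rewrite big_cons -IH -differenceD; apply: eq_difference => y' _.
by rewrite big_cons.
Qed.

Lemma difference_depends p cs f y y' : depends_on p f ->
  (forall z, p z -> y z = y' z) -> difference cs f y = difference cs f y'.
Proof.
move=> hf; elim: cs y y' => [|x cs IH] y y' e /=; first exact: hf.
by congr (_ - _); apply: IH => z /e; rewrite /update; case: eqP.
Qed.

Lemma difference_independent x cs f y :
  depends_on (predC1 x) f -> x \in cs -> difference cs f y = 0.
Proof.
move=> hf; elim: cs y => //= z cs IH y; rewrite inE.
have [<- _|_ /= xcs] := eqVneq x z; last by rewrite !IH // subr0.
rewrite (@difference_depends _ cs f _ (update y x 0) hf) ?subrr // => t /= nt.
by rewrite /update (negPf nt).
Qed.

(** A cube is the product of the cubes on the variables of each factor. *)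
Lemma differenceM p cs f g y : depends_on p f -> depends_on (predC p) g ->
  difference cs (fun y => f y * g y) y
    = difference (filter p cs) f y * difference (filter (predC p) cs) g y.
Proof.
move=> hf hg; elim: cs y => //= x cs IH y; rewrite !IH; case: ifPn => px /=.
  rewrite mulrBl; congr (_ - _ * _).
    congr (_ * _); apply: difference_depends hg _ => z /= nz.
    by rewrite /update; case: eqP => // e; rewrite e px in nz.
  apply: difference_depends hg _ => z /= nz.
  by rewrite /update; case: eqP => // e; rewrite e px in nz.
rewrite mulrBr; congr (_ * _ - _ * _); apply: difference_depends hf _ => z /= pz;
  by rewrite /update; case: eqP => // e; rewrite -e pz in px.
Qed.

Lemma difference_monomial s cs y : uniq cs -> (size s <= size cs)%N ->
  difference cs (monomial s) y = (perm_eq s cs)%:R.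
Proof.
elim: cs s y => [|x cs IH] s y /=.
  by rewrite leqn0 size_eq0 => _ /eqP->; rewrite /monomial big_nil.
case/andP=> ncs ucs les.
have [xs|nxs] := boolP (x \in s); last first.
  have hd : depends_on (predC1 x) (monomial s).
    move=> z z' e; rewrite /monomial; apply: eq_big_seq => h hs; apply: e.
    by apply: contraNneq nxs => /= <-.
  rewrite (@difference_depends _ cs _ _ (update y x 0) hd); last first.
    by move=> t /= nt; rewrite /update (negPf nt).
  rewrite subrr; case: (boolP (perm_eq _ _)) => // /perm_mem/(_ x).
  by rewrite (negPf nxs) mem_head.
rewrite [X in _ - X](_ : _ = 0) ?subr0; last first.
  rewrite -[RHS](difference0 cs (update y x 0)); apply: eq_difference => y' e.
  rewrite /monomial (perm_big _ (perm_to_rem xs)) big_cons /= e //.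
  by rewrite /update eqxx mul0r.
rewrite (permPl (perm_to_rem xs)) perm_cons -(IH _ (update y x 1)) //; last first.
  by move: les; rewrite (perm_size (perm_to_rem xs)).
apply: eq_difference => y' e.
rewrite /monomial (perm_big _ (perm_to_rem xs)) big_cons /= e //.
by rewrite /update eqxx mul1r.
Qed.

(** Only the monomials that use every variable exactly once survive. *)
Lemma difference_poly (H : eqType) (ch : H -> C) (d : H -> int) l cs y :
  uniq cs -> all (fun c : int * seq H => size c.2 <= size cs)%N l ->
  difference cs (fun y => poly_eval l (fun h => d h * y (ch h))) y
    = \sum_(c <- l | perm_eq (map ch c.2) cs) c.1 * monomial c.2 d.
Proof.
move=> ucs hl; rewrite difference_sum [RHS]big_mkcond /=.
apply: eq_big_seq => c /(allP hl) lec; rewrite differenceZ.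
have := @difference_monomial (map ch c.2) cs y ucs.
rewrite size_map => /(_ lec) em; have -> : difference cs
    (fun y => monomial c.2 (fun h => d h * y (ch h))) y
    = monomial c.2 d * difference cs (monomial (map ch c.2)) y.
  rewrite -differenceZ; apply: eq_difference => y' _.
  by rewrite /monomial big_map big_split.
by rewrite em; case: (perm_eq _ _); rewrite ?mulr1 ?mulr0.
Qed.

Lemma difference_scale (f : (C -> int) -> int) (sg : C -> int) cs y :
  uniq cs -> poly_le (size cs) f ->
  difference cs (fun y => f (fun x => sg x * y x)) y
    = \prod_(x <- cs) sg x * difference cs f y.
Proof.
move=> ucs [l hl el]; rewrite (eq_difference (g := fun y =>
    poly_eval l (fun x => sg x * y x))); last by move=> y' _; rewrite el.
rewrite (difference_poly id) //.
have -> : difference cs f y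
   = \sum_(c <- l | perm_eq (map id c.2) cs) c.1 * monomial c.2 (fun=> 1).
  rewrite -(difference_poly id (fun=> 1) y ucs hl).
  apply: eq_difference => y' _; rewrite el /poly_eval; apply: eq_bigr => c _.
  by congr (_ * _); apply: eq_bigr => x _; rewrite mul1r.
rewrite big_distrr /=; apply: eq_bigr => c; rewrite map_id => pc.
by rewrite /monomial [X in _ = _ * (_ * X)]big1 // mulr1 mulrC (perm_big _ pc).
Qed.

Lemma difference_degree d f cs y :
  uniq cs -> (d < size cs)%N -> poly_le d f -> difference cs f y = 0.
Proof.
move=> ucs lt [l hl el].
have hl' : all (fun c : int * seq C => size c.2 <= size cs)%N l.
  by apply: sub_all hl => c; move/leq_ltn_trans/(_ lt)/ltnW.
rewrite (eq_difference (g := fun y => poly_eval l (fun x => 1 * y x))).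
  rewrite (difference_poly id) // big1_seq // => c /andP[pc cl].
  by move: (allP hl c cl); rewrite leqNgt -(size_map id) (perm_size pc) lt.
move=> y' _; rewrite el /poly_eval; apply: eq_bigr => c _.
by congr (_ * _); apply: eq_bigr => x _; rewrite mul1r.
Qed.

End Differences.

(** The alternating sum over the resolutions of the double points: [v] and [u]
    are the values at the positive and at the negative resolution. For one
    monomial it factors over the crossings, and the factor of a double point that
    the monomial does not meet is [1 - 1]. *)
Lemma alternating_sum_poly (N : nat) (dbl : {set 'I_N}) (H : eqType)
    (ch : H -> 'I_N) (y : {set 'I_N} -> H -> int) (y0 u v : H -> int)
    (l : seq (int * seq H)) :
  (forall A h, y A h =
     if ch h \in dbl then if ch h \in A then u h else v h else y0 h) ->
  all (fun c : int * seq H => size c.2 <= #|dbl|)%N l ->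
  \sum_(A in powerset dbl) (-1) ^+ #|A| * poly_eval l (y A)
    = \sum_(c <- l | perm_eq (map ch c.2) (enum dbl))
        c.1 * monomial c.2 (fun h => v h - u h).
Proof.
move=> hy hl; rewrite [RHS]big_mkcond /=.
under eq_bigr => A _ do rewrite /poly_eval big_distrr /=.
rewrite exchange_big /=; apply: eq_big_seq => -[c m] /(allP hl) /= lem.
under eq_bigr => A _ do rewrite mulrCA.
rewrite -big_distrr /=.
suff -> : \sum_(A in powerset dbl) (-1) ^+ #|A| * monomial m (y A)
    = if perm_eq (map ch m) (enum dbl) then monomial m (fun h => v h - u h) else
      0.
  by case: ifP => _; rewrite ?mulr0.
pose F x : int := if x \in dbl then - \prod_(h <- m | ch h == x) u h else 0.
pose G x : int := if x \in dbl then \prod_(h <- m | ch h == x) v h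
                  else \prod_(h <- m | ch h == x) y0 h.
have -> : \sum_(A in powerset dbl) (-1) ^+ #|A| * monomial m (y A)
    = \prod_x (F x + G x).
  rewrite bigA_distr [LHS]big_mkcond /=; apply: eq_bigr => A _.
  rewrite powersetE; case: ifPn => [sA|/subsetPn[x xA nx]]; last first.
    by rewrite (bigD1 x) //= xA /F (negPf nx) mul0r.
  rewrite /monomial (partition_big ch predT) //= -prodr_const.
  rewrite [X in X * _]big_mkcond -big_split /=; apply: eq_bigr => x _.
  rewrite /F /G; case: ifPn => xA.
    rewrite (subsetP sA) // mulN1r; congr (- _); apply: eq_bigr => h /eqP ex.
    by rewrite hy ex (subsetP sA) // xA.
  rewrite mul1r; case: ifP => xd; apply: eq_bigr => h /eqP ex;
    rewrite hy ex xd //.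
  by rewrite (negPf xA).
have hfilter x : count (fun h => ch h == x) m = count_mem x (map ch m).
  by rewrite count_map.
have [sub|] := boolP (all (mem (map ch m)) (enum dbl)); last first.
  rewrite -has_predC => /hasP[x /=]; rewrite mem_enum => xd nx.
  rewrite (bigD1 x) //= /F /G xd.
  have e0 z : \prod_(h <- m | ch h == x) z h = 1 :> int.
    rewrite -big_filter; have -> : [seq h <- m | ch h == x] = [::];
      last by rewrite big_nil.
    apply/eqP; rewrite -size_eq0 size_filter hfilter.
    by apply/eqP/count_memPn.
  rewrite !e0 addNr mul0r; case: (boolP (perm_eq _ _)) => // /perm_mem/(_ x).
  by rewrite mem_enum xd (negPf nx).
have pm : perm_eq (map ch m) (enum dbl).
  have [|es em] := uniq_min_size (enum_uniq dbl) (allP sub).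
    by rewrite size_map -cardE.
  rewrite perm_sym; apply: uniq_perm => //; first exact: enum_uniq.
  by rewrite -(eq_uniq es em) enum_uniq.
rewrite pm /monomial (partition_big ch predT) //=; apply: eq_bigr => x _.
have [xd|nxd] := boolP (x \in dbl).
  have : size [seq h <- m | ch h == x] = 1%N.
    by rewrite size_filter hfilter (permP pm) count_uniq_mem ?enum_uniq //
      mem_enum xd.
  rewrite /F /G xd -!(big_filter m); case: [seq _ <- _ | _] => [|h [|]] //= _.
  by rewrite !big_seq1 addrC.
have e0 : [seq h <- m | ch h == x] = [::].
  apply/eqP; rewrite -size_eq0 size_filter hfilter; apply/eqP/count_memPn.
  by rewrite (perm_mem pm) mem_enum.
by rewrite /F /G (negPf nxd) -!(big_filter m) e0 !big_nil add0r.
Qed.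

(** * The Wirtinger group acts by triangular matrices *)

Definition gauss_wf (L : tangle_diagram) : bool :=
  uniq (td_labels L) &&
  perm_eq (flatten [seq td_strand L i | i <- td_labels L])
          (enum {: 'I_(td_ncross L) * bool}).

Section Passes.
Variable L : tangle_diagram.

Local Notation pass := ('I_(td_ncross L) * bool)%type.

Implicit Types (p : pass) (s : seq pass) (x : 'I_(td_ncross L)).

Definition pass_label p : nat :=
  nth 0%N (td_labels L)
      (find (fun i => p \in td_strand L i) (td_labels L)).

Definition passes_before p : seq pass :=
  take (index p (td_strand L (pass_label p))) (td_strand L (pass_label p)).

Definition opposite p : pass := (p.1, ~~ p.2).

(** A crossing of a component with itself is given no label, since it
    contributes nothing to the coefficient of a word without repetition. *)
Definition over_label p : option nat :=
  if pass_label (opposite p) == pass_label p then None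
  else Some (pass_label (opposite p)).

Definition over_word p : seq (pass * bool) :=
  positive_word (passes_before (opposite p)).

Definition pass_sign p : int := if p.2 then 0 else (-1) ^+ (~~ td_pos L p.1).

Definition under s := [seq p <- s | ~~ p.2].

Lemma size_under s : size (under s) = nunder s.
Proof. exact: size_filter. Qed.

Lemma take_under s1 s2 : take (nunder s1) (under (s1 ++ s2)) = under s1.
Proof. by rewrite /under filter_cat -size_under take_size_cat. Qed.

Lemma nunder_split s t : (t <= nunder s)%N ->
  exists s1 s2, s = s1 ++ s2 /\ nunder s1 = t.
Proof.
elim: s t => [|p s IH] t /=; first by case: t => // _; exists [::], [::].
case: t => [|t]; first by exists [::], (p :: s).
case ep: p.2 => /=; [rewrite add0n => /IH|rewrite add1n ltnS => /IH].
  by case=> s1 [s2 [-> e]]; exists (p :: s1), s2; rewrite /= ep add0n.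
by case=> s1 [s2 [-> e]]; exists (p :: s1), s2; rewrite /= ep add1n e.
Qed.

Section Wf.
Hypothesis wfL : gauss_wf L.

Lemma mem_flatten_strand p :
  exists2 i, i \in td_labels L & p \in td_strand L i.
Proof.
case/andP: wfL => _ /perm_mem/(_ p); rewrite mem_enum => /flatten_mapP[i iL pi].
by exists i.
Qed.

Lemma has_strand p : has (fun i => p \in td_strand L i) (td_labels L).
Proof. by apply/hasP; have [i] := mem_flatten_strand p; exists i. Qed.

Lemma pass_label_labels p : pass_label p \in td_labels L.
Proof. by rewrite mem_nth // -has_find has_strand. Qed.

Lemma mem_pass_label p : p \in td_strand L (pass_label p).
Proof. exact: nth_find (has_strand p). Qed.

Lemma count_strand p : (\sum_(i <- td_labels L) count_mem p (td_strand L i) =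
  1)%N.
Proof.
case/andP: wfL => _ /permP/(_ (pred1 p)); rewrite count_flatten -map_comp.
rewrite sumnE big_map => ->.
by rewrite count_uniq_mem ?enum_uniq // mem_enum.
Qed.

Lemma pass_labelE p i :
  i \in td_labels L -> p \in td_strand L i -> pass_label p = i.
Proof.
move=> iL pi; apply/eqP/contraT => ne; have := count_strand p.
have uL : uniq (td_labels L) by case/andP: wfL.
rewrite (big_rem i) //= (big_rem (pass_label p)) /=; last first.
  by rewrite mem_rem_uniq // inE ne pass_label_labels.
have := mem_pass_label p; rewrite -has_pred1 has_count.
move: pi; rewrite -has_pred1 has_count.
by move: (count_mem _ _) (count_mem _ _) (\sum_(_ <- _) _)%N => a b d; lia.
Qed.

Lemma strand_split_before i s1 p s2 : i \in td_labels L ->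
  td_strand L i = s1 ++ p :: s2 -> passes_before p = s1.
Proof.
move=> iL es; have pi : p \in td_strand L i by rewrite es mem_cat mem_head orbT.
have uL : uniq (td_labels L) by case/andP: wfL.
rewrite /passes_before (pass_labelE iL pi) es index_cat.
have np : p \notin s1.
  have := count_strand p; rewrite (bigD1_seq i) // es count_cat /= eqxx => e.
  apply/count_memPn; move: e.
  by move: (count_mem _ s1) (count_mem _ s2) (\sum_(_ <- _ | _) _)%N => a b d;
    lia.
by rewrite (negPf np) /= eqxx addn0 take_size_cat.
Qed.

Lemma strand_split p : exists s2,
  td_strand L (pass_label p) = passes_before p ++ p :: s2.
Proof.
have pi := mem_pass_label p.
exists (drop (index p (td_strand L (pass_label p))).+1 (td_strand L (pass_label
  p))).
rewrite -{1}(cat_take_drop (index p (td_strand L (pass_label p)))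
  (td_strand L (pass_label p))) (drop_nth p) ?index_mem //.
by rewrite nth_index.
Qed.

End Wf.

End Passes.

Section WirtingerMatrices.
Variables (L : tangle_diagram) (I : seq nat).
Hypotheses (wfL : gauss_wf L) (uI : uniq I).

Local Notation mx := 'M[int]_((size I).+1).
Local Notation pass := ('I_(td_ncross L) * bool)%type.

Definition strand_expansion : seq (pass * bool) -> mx :=
  expansion I (@pass_sign L) (@over_label L) (@over_word L).

Local Notation conj :=
  (conjugate_letter I (@pass_sign L) (@over_label L) (@over_word L)).

Definition arc_conjugate (a : Defs.arc) : mx :=
  conj (Some a.1) (positive_word (take a.2 (under (td_strand L a.1)))).

Definition arc_mx (l : Defs.arc * bool) : mx :=
  1 + (-1) ^+ (~~ l.2) *: arc_conjugate l.1.

Definition word_mx (w : word) : mx := \prod_(l <- w) arc_mx l.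

Lemma word_mx_cat u v : word_mx (u ++ v) = word_mx u * word_mx v.
Proof. exact: big_cat. Qed.

Lemma word_mx_nil : word_mx [::] = 1.
Proof. exact: big_nil. Qed.

Lemma word_mx_seq1 l : word_mx [:: l] = arc_mx l.
Proof. exact: big_seq1. Qed.

Lemma strand_expansion_under s :
  strand_expansion (positive_word s) = strand_expansion (positive_word (under s)).
Proof.
elim: s => //= p s IH;
  rewrite /strand_expansion expansion_cons -/strand_expansion.
case ep: p.2 => /=; last by rewrite IH /strand_expansion expansion_cons.
by rewrite {1}/pass_sign ep mulr0 scale0r addr0 mul1r IH.
Qed.

Lemma over_arcE x : over_arc x =
  (pass_label (x, true), nunder (L := L) (passes_before (x, true))).
Proof. by []. Qed.

Lemma arc_conjugate_over x : arc_conjugate (over_arc x)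
  = conj (Some (pass_label (x, true))) (over_word (x, false)).
Proof.
rewrite over_arcE /arc_conjugate /=.
have [s2 es] := strand_split wfL (x, true); rewrite es take_under.
by apply: eq_conjugate_letter => //; symmetry; exact: strand_expansion_under.
Qed.

Lemma arc_mx_cancel a e : arc_mx (a, e) * arc_mx (a, ~~ e) = 1.
Proof.
have := one_addZ_conjugate (@pass_sign L) (@over_label L) (@over_word L) uI
  (if e then -1 else 1) (Some a.1) (positive_word (take a.2 (under (td_strand L
    a.1)))).
rewrite -/(arc_conjugate a) /arc_mx /= negbK.
by case: e; rewrite /= ?expr0 ?expr1 !scaleN1r !scale1r ?opprK.
Qed.

Lemma order_ge_arc_conjugate a : order_ge 1 (arc_conjugate a).
Proof. exact: order_ge_conjugate_letter. Qed.

(** The relation at an undercrossing of [i] holds because passing it multiplies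
    the word conjugating the meridian of [i] by the arc above. *)
Lemma group_eq_mx u v : group_eq L u v -> word_mx u = word_mx v.
Proof.
elim=> // {u v} [u v w _ -> _ ->//|u v a e _|u v i s1 s2 x iL es].
  rewrite !word_mx_cat -[[:: _; _]]/([:: (a, e)] ++ [:: (a, ~~ e)]) word_mx_cat.
  by rewrite !word_mx_seq1 arc_mx_cancel mul1r.
rewrite !word_mx_cat; congr (_ * (_ * _)).
rewrite -[[:: _; _; _]]/([:: _] ++ [:: _] ++ [:: _]) !word_mx_cat !word_mx_seq1.
rewrite /arc_mx /= expr0 !scale1r.
have ei : pass_label (x, false) = i.
  by apply: pass_labelE => //; rewrite es mem_cat mem_head orbT.
set Z := arc_conjugate (i, nunder (L := L) s1).
set Y := arc_conjugate (over_arc x).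
have eY : Y = conj (Some (pass_label (x, true))) (over_word (x, false)).
  exact: arc_conjugate_over.
have {}eZ : Z = conj (Some i) (positive_word (under s1)).
  by rewrite /Z /arc_conjugate /= es take_under.
have eT : arc_conjugate (i, (nunder (L := L) s1).+1)
    = conj (Some i) (positive_word (under s1) ++ [:: ((x, false), true)]).
  rewrite /arc_conjugate /= es.
  have -> : take (nunder (L := L) s1).+1 (under (s1 ++ (x, false) :: s2))
      = under s1 ++ [:: (x, false)].
    rewrite -cat1s catA -[X in take X](_ : nunder (L := L) (s1 ++ [:: (x,
      false)]) = _).
      by rewrite take_under /under filter_cat.
    by rewrite /nunder count_cat /= addn1.
  by rewrite /positive_word map_cat.
have eF b : expansion I (@pass_sign L) (@over_label L) (@over_word L)
      [:: ((x, false), b)] = if pass_label (x, true) == i then 1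
      else 1 + (-1) ^+ (~~ b (+) ~~ td_pos L x) *: Y.
  rewrite expansion_seq1 /pass_sign /= signr_addb /over_label /opposite /= ei.
  rewrite eY; case: eqP => // _.
  by rewrite /conjugate_letter letter_mx_none mulr0 mul0r scaler0 addr0.
set c : int := (-1) ^+ (~~ td_pos L x).
have -> : (-1) ^+ (~~ ~~ td_pos L x) = - c :> int by rewrite /c;
  case: (td_pos L x).
have one : (1 + - c *: Y) * (1 + c *: Y) = 1.
  by rewrite scaleNr eY one_addZ_conjugate.
rewrite eT {1}/conjugate_letter formal_inverse_cat !expansion_cat /= !eF.
have -> : (-1) ^+ (~~ ~~ ((x, false), true).2 (+) ~~ td_pos L x) = - c :> int.
  by rewrite /c; case: (td_pos L x).
rewrite -/c (mulrDl 1 Z) mul1r mulrDr one; congr (_ + _).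
case: eqP => [e|_]; last by rewrite eZ /conjugate_letter !mulrA.
rewrite mul1r mulr1 -/(conj (Some i) _) -eZ.
have ZY : Z * Y = 0 by rewrite eY eZ e conjugate_letter_mul.
have YZ : Y * Z = 0 by rewrite eY eZ e conjugate_letter_mul.
by rewrite mulrDr mulr1 -scalerAr ZY scaler0 addr0 mulrDl mul1r -scalerAl YZ
  scaler0 addr0.
Qed.

Lemma order_ge_arc_mx l : order_ge 0 (arc_mx l).
Proof.
apply: order_geD; first exact: order_ge1.
by apply: order_geZ; apply: order_geW (order_ge_arc_conjugate _).
Qed.

Lemma order_ge_word_mx w : order_ge 0 (word_mx w).
Proof.
elim: w => [|l w IH]; first by rewrite word_mx_nil; exact: order_ge1.
by rewrite -cat1s word_mx_cat word_mx_seq1; apply: order_geMl => //;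
  apply: order_ge_arc_mx.
Qed.

Lemma word_mx_winv u : word_mx (winv u) * word_mx u = 1.
Proof.
elim: u => [|[a e] u IH]; first by rewrite word_mx_nil mulr1.
rewrite -cat1s -[winv _]/(formal_inverse _) formal_inverse_cat !word_mx_cat.
rewrite mulrA -(mulrA _ _ (word_mx [:: _])) !word_mx_seq1 /=.
by rewrite -{2}[e]negbK arc_mx_cancel mulr1.
Qed.

Lemma winvK : involutive winv.
Proof. exact: formal_inverseK. Qed.

Lemma word_mx_winv_r u : word_mx u * word_mx (winv u) = 1.
Proof. by rewrite -{1}[u]winvK word_mx_winv. Qed.

Lemma order_ge_word_mx1 w : order_ge 1 (word_mx w - 1).
Proof.
elim: w => [|l w IH]; first by rewrite word_mx_nil subrr; apply: order_ge00.
rewrite -cat1s word_mx_cat word_mx_seq1 -[X in _ - X]mulr1.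
apply: order_ge_subM => //; [exact: order_ge1|exact: order_ge_word_mx|].
by rewrite addrAC subrr add0r; apply: order_geZ; exact: order_ge_arc_conjugate.
Qed.

(** Orders add up in commutators, since
    [UV - VU = (U - 1)(V - 1) - (V - 1)(U - 1)]. *)
Lemma lower_central_mx q u :
  lower_central L q u -> order_ge q (word_mx u - 1).
Proof.
elim=> {q u} [w _|q u v _ IH _|q u v _ IHu _ IHv|q u _ IH|q u v e _].
- exact: order_ge_word_mx1.
- rewrite !word_mx_cat; set U := word_mx u in IH *; set V := word_mx v.
  set U' := word_mx (winv u); set V' := word_mx (winv v).
  have -> : U' * (V' * (U * V)) - 1 =
      U' * V' * ((U - 1) * (V - 1) - (V - 1) * (U - 1)).
    have e (A B : mx) : (A - 1) * (B - 1) = A * B - (A + B - 1).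
      by rewrite mulrBl mulrBr mulr1 mul1r !opprD opprK !addrA.
    rewrite !e (addrC V U); move: (U + V - 1) => W; rewrite opprB addrA subrK.
    rewrite mulrBr !mulrA; congr (_ - _).
    by rewrite -!mulrA (mulrA V') word_mx_winv mul1r word_mx_winv.
  apply: order_geMl; first by apply: order_geMl; exact: order_ge_word_mx.
  have oV : order_ge 1 (V - 1) by exact: order_ge_word_mx1.
  apply: order_geD; first by rewrite -addn1; apply: order_geM.
  by apply: order_geN; rewrite -add1n; apply: order_geM.
- rewrite word_mx_cat -[X in _ - X]mulr1; apply: order_ge_subM => //.
    exact: order_ge1.
  exact: order_ge_word_mx.
- have -> : word_mx (winv u) - 1 = - (word_mx (winv u) * (word_mx u - 1)).
    by rewrite mulrBr mulr1 word_mx_winv opprB.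
  by apply/order_geN/order_geMl => //; exact: order_ge_word_mx.
- by rewrite (group_eq_mx e).
Qed.

End WirtingerMatrices.

(** * Magnus expansions as matrices *)

Section Subwords.
Variable I : seq nat.

Local Notation mx := 'M[int]_((size I).+1).

Lemma size_subword s t : (t <= size I)%N -> size (subword I s t) = (t - s)%N.
Proof. by move=> le; rewrite size_take size_drop; case: ltnP; lia. Qed.

Lemma uniq_subword s t : uniq I -> uniq (subword I s t).
Proof. by move=> uI; exact/take_uniq/drop_uniq. Qed.

Lemma subword1 a i : (a < size I)%N ->
  (subword I a a.+1 == [:: i]) = (onth I a == Some i).
Proof.
move=> lt; rewrite /subword subSnn onthE (drop_nth i) //= take0.
by rewrite (nth_map i) // eqseq_cons eqxx andbT.
Qed.

Lemma series_mul_mx f g (X Y : mx) (a b : 'I_((size I).+1)) :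
  order_ge 0 X -> order_ge 0 Y ->
  (forall a b : 'I_((size I).+1), a <= b -> X a b = f (subword I a b))%N ->
  (forall a b : 'I_((size I).+1), a <= b -> Y a b = g (subword I a b))%N ->
  (a <= b)%N -> (X * Y) a b = series_mul f g (subword I a b).
Proof.
move=> oX oY hX hY le; have lb := ltn_ord b.
rewrite -mulmxE mxE /series_mul size_subword //.
pose F r := X a (inord r) * Y (inord r) b.
have -> : \sum_j X a j * Y j b = \sum_(0 <= r < (size I).+1) F r.
  by rewrite big_mkord; apply: eq_bigr => r _; rewrite /F inord_val.
rewrite (@big_cat_nat _ _ _ a) //=; last by apply: ltnW; exact: ltn_ord.
rewrite (@big_cat_nat _ _ _ b.+1 a) //=; last by apply: leqW.
rewrite big_nat big1 ?add0r; last first.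
  move=> r /andP[_ lt]; rewrite /F oX ?mul0r // inordK; first by rewrite addn0.
  by apply: ltn_trans lt _; exact: ltn_ord.
rewrite [X in _ + X]big_nat [X in _ + X]big1 ?addr0; last first.
  by move=> r /andP[lt lt']; rewrite /F (oY (inord r)) ?mulr0 // inordK // addn0.
rewrite -{1}[nat_of_ord a]add0n big_addn subSn // [LHS]big_nat [RHS]big_nat.
apply: eq_bigr => r /andP[_ lt]; have lr : (r + a < (size I).+1)%N by lia.
rewrite /F hX ?inordK //; last by lia.
rewrite hY ?inordK //; last by lia.
rewrite /subword addnK take_takel; last by lia.
have -> : (b - a = (b - (r + a)) + r)%N by lia.
by rewrite -take_drop drop_drop.
Qed.

End Subwords.

Section MagnusMatrices.
Variables (L : tangle_diagram) (I : seq nat).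
Hypothesis uI : uniq I.

Local Notation wmx := (word_mx L I).

Lemma arc_mx_meridian i e (a b : 'I_((size I).+1)) : (a <= b)%N ->
  arc_mx L I ((i, 0%N), e) a b = magnus_gen i e (subword I a b).
Proof.
move=> le; have lb := ltn_ord b.
rewrite /arc_mx /arc_conjugate /= take0 /conjugate_letter expansion_nil.
rewrite mul1r mulr1 !mxE /magnus_gen size_subword //.
have [eab|ne] := eqVneq (a : nat) b.
  rewrite eab subnn /subword subnn take0 /=.
  have -> : (a == b) = true by apply/eqP/val_inj.
  by rewrite (ltn_eqF (ltnSn b)) /= mulr0 addr0; case: e.
have -> : (a == b) = false by apply: contraNF ne => /eqP->.
rewrite add0r; have [eb|neb] := eqVneq (b : nat) a.+1.
  have lta : (a < size I)%N by rewrite -eb.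
  have sz := size_subword a (lta : a.+1 <= size I)%N.
  rewrite eb subSnn /= subword1 //; case: (subword I a a.+1) sz => [|x [|]];
    rewrite ?subSnn //= => _.
  by case: e; case: (onth _ _ == _); rewrite /= ?mulr1 ?mulr0 ?expr0 ?expr1.
rewrite /= mulr0.
have lt2 : (1 < b - a)%N by lia.
have := size_subword a lb; have := uniq_subword a b uI.
case: (subword I a b) => [|x [|z s]] /= us es; try by rewrite -es in lt2.
move: us; rewrite inE negb_or => /andP[/andP[nxz _] _]; case: e;
  first by rewrite eqseq_cons andbF.
rewrite -es /= !eqseq_cons; case: eqP => //= ex; case: eqP => //= ez.
by move: nxz; rewrite ex ez eqxx.
Qed.

Lemma word_mx_magnus w (a b : 'I_((size I).+1)) : (a <= b)%N ->
  wmx (meridian_word w) a b = magnus w (subword I a b).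
Proof.
elim: w a b => [|[i e] w IH] a b le; have lb := ltn_ord b.
  rewrite word_mx_nil !mxE /= /series_one.
  rewrite -size_eq0 size_subword //.
  by congr (_ (nat_of_bool _)); apply/eqP/eqP => [->|h];
    [rewrite subnn|apply: val_inj; rewrite /=; lia].
rewrite -[meridian_word _]/([:: ((i, 0%N), e)] ++ meridian_word w) word_mx_cat
  word_mx_seq1.
apply: series_mul_mx => //; [exact: order_ge_arc_mx|exact: order_ge_word_mx|].
exact: arc_mx_meridian.
Qed.

End MagnusMatrices.

(** * Meridian words for longitudes *)

Section MilnorAlgorithm.
Variable L : tangle_diagram.
Hypothesis wfL : gauss_wf L.

Local Notation "u ~ v" := (group_eq L u v) (at level 70).

Lemma is_arc_over (x : 'I_(td_ncross L)) : is_arc L (over_arc x).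
Proof.
rewrite over_arcE /is_arc /= pass_label_labels //=.
have [s2 ->] := strand_split wfL (x, true).
by rewrite /nunder count_cat leq_addr.
Qed.

Lemma group_eq_ctx x y u v : u ~ v -> x ++ u ++ y ~ x ++ v ++ y.
Proof.
elim=> {u v} [w|u v _ h|u v w _ h1 _ h2|u v a e ha|u v i s1 s2 z iL es].
- exact: group_eq_refl.
- exact: group_eq_sym.
- exact: group_eq_trans h2.
- by have := group_eq_cancel (x ++ u) (v ++ y) e ha; rewrite -!catA.
- by have := group_eq_wirtinger (x ++ u) (v ++ y) iL es; rewrite -!catA.
Qed.

Lemma group_eq_cat u u' v v' : u ~ u' -> v ~ v' -> u ++ v ~ u' ++ v'.
Proof.
move=> eu ev; apply: (group_eq_trans (v := u' ++ v)).
  exact: (group_eq_ctx [::] v eu).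
by have := group_eq_ctx u' [::] ev; rewrite !cats0.
Qed.

Lemma is_word_cat u v : is_word L (u ++ v) = is_word L u && is_word L v.
Proof. exact: all_cat. Qed.

Lemma is_word_winv u : is_word L (winv u) = is_word L u.
Proof. by rewrite /is_word /winv all_rev all_map. Qed.

Lemma is_word_group_eq u v : u ~ v -> is_word L u = is_word L v.
Proof.
elim=> {u v} // [u v w _ -> //|u v a e ha|u v i s1 s2 x iL es].
  by rewrite !is_word_cat /= ha.
rewrite !is_word_cat /= is_arc_over /= !andbT.
rewrite /is_arc /= iL es /nunder count_cat /=.
move: (count _ s1) (count _ s2) => m k.
have h : (m < m + (1 + k))%N by rewrite add1n addnS ltnS leq_addr.
by rewrite h (ltnW h).
Qed.

Lemma group_eq_invl u : is_word L u -> winv u ++ u ~ [::].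
Proof.
elim: u => [|[a e] u IH] /=; first by move=> _; exact: group_eq_refl.
case/andP=> ha hu; apply: group_eq_trans (IH hu).
have := group_eq_cancel (winv u) u (~~ e) ha; rewrite negbK.
rewrite -(cat1s (a, e) u) -[winv ([:: (a, e)] ++ u)]/(formal_inverse _).
by rewrite formal_inverse_cat -catA.
Qed.

Lemma winv_cat u v : winv (u ++ v) = winv v ++ winv u.
Proof. exact: formal_inverse_cat. Qed.

Lemma group_eq_cancell x u y : is_word L u -> x ++ winv u ++ u ++ y ~ x ++ y.
Proof. by move=> /group_eq_invl/(group_eq_ctx x y); rewrite -catA. Qed.

Lemma group_eq_cancelr x u y : is_word L u -> x ++ u ++ winv u ++ y ~ x ++ y.
Proof.
by move=> hu; rewrite -{1}[u](winvK u); apply: group_eq_cancell;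
  rewrite is_word_winv.
Qed.

Lemma is_word_lower_central q u : lower_central L q u -> is_word L u.
Proof.
elim=> {q u} // [q u v _ hu hv|q u v _ hu _ hv|q u _|q u v /is_word_group_eq->
  //].
- by rewrite !is_word_cat !is_word_winv hu hv.
- by rewrite is_word_cat hu.
- by rewrite is_word_winv.
Qed.

Lemma lower_centralW q u : lower_central L q.+1 u -> (0 < q)%N ->
  lower_central L q u.
Proof.
move eq1: q.+1 => q1 h;
  elim: h q eq1 => {q1 u} [w _|q1 u v hu IH hv|q1 u v _ IHu _ IHv|q1 u _ IH|q1 u
    v e _ IH] q.
- by case=> ->.
- case=> -> {q}; case: q1 hu IH => // -[|q1] hu IH _.
    apply: lower_central_top; rewrite !is_word_cat !is_word_winv hv.
    by rewrite (is_word_lower_central hu).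
  by apply: lower_central_comm => //; exact: IH.
- by move=> eq q0; apply: lower_central_mul; [exact: IHu|exact: IHv].
- by move=> eq q0; apply: lower_central_inv; exact: IH.
- by move=> eq q0; apply: lower_central_eq e _; exact: IH.
Qed.

Lemma lower_central_conj q u v : (0 < q)%N -> lower_central L q u -> is_word L
  v ->
  lower_central L q (winv v ++ u ++ v).
Proof.
move=> q0 hu hv; have wu := is_word_lower_central hu.
have h := lower_central_mul hu (lower_centralW (lower_central_comm hu hv) q0).
apply: lower_central_eq h.
by have := group_eq_cancelr [::] (winv v ++ u ++ v) wu.
Qed.

Lemma lower_central_nil q : (0 < q)%N -> lower_central L q [::].
Proof.
case: q => // q _; elim: q => [|q IH]; first exact: lower_central_top.
by have := lower_central_comm IH (isT : is_word L [::]).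
Qed.

(** Congruence of words modulo the term of index [q]. *)
Definition cong q (u v : word) :=
  [/\ is_word L u, is_word L v & lower_central L q (winv u ++ v)].

Lemma group_eq_cong q u v : (0 < q)%N -> is_word L u -> u ~ v -> cong q u v.
Proof.
move=> q0 hu e; split=> //; first by rewrite -(is_word_group_eq e).
apply: lower_central_eq (lower_central_nil q0); apply: group_eq_sym.
apply: group_eq_trans (group_eq_invl hu).
by apply: group_eq_cat; [exact: group_eq_refl|exact: group_eq_sym].
Qed.

Lemma cong_trans q u v w : cong q u v -> cong q v w -> cong q u w.
Proof.
case=> hu hv huv [_ hw hvw]; split=> //.
apply: lower_central_eq (lower_central_mul huv hvw).
by rewrite -catA; exact: group_eq_cancelr.
Qed.

Lemma cong_cat q u u' v v' : (0 < q)%N ->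
  cong q u u' -> cong q v v' -> cong q (u ++ v) (u' ++ v').
Proof.
move=> q0 [hu hu' cu] [hv hv' cv]; split; rewrite ?is_word_cat ?hu ?hu' //.
have h := lower_central_mul (lower_central_conj q0 cu hv) cv.
apply: lower_central_eq h; rewrite winv_cat -!catA.
by have := group_eq_cancelr (winv v ++ winv u ++ u') v' hv; rewrite -!catA.
Qed.

Lemma cong_winv q u v : (0 < q)%N -> cong q u v -> cong q (winv u) (winv v).
Proof.
move=> q0 [hu hv cuv]; split; rewrite ?is_word_winv // winvK.
have hw : is_word L (winv u) by rewrite is_word_winv.
have h := lower_central_inv (lower_central_conj q0 cuv hw).
apply: lower_central_eq h; rewrite winvK !winv_cat !winvK -!catA.
by have := group_eq_cancelr (u ++ winv v) [::] hu; rewrite !cats0 -!catA.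
Qed.

(** Conjugating by words that agree modulo the term of index [q] gains one
    degree: with [g] the quotient of these words, the two conjugates of [a]
    differ by the commutator of [g] with one of them. *)
Lemma cong_conj q u v a : (0 < q)%N -> is_word L a -> cong q u v ->
  cong q.+1 (winv u ++ a ++ u) (winv v ++ a ++ v).
Proof.
move=> q0 ha [hu hv cuv]; split;
  rewrite ?is_word_cat ?is_word_winv ?hu ?hv ?ha //.
have hb : is_word L (winv u ++ a ++ u).
  by rewrite !is_word_cat is_word_winv hu ha.
have h := lower_central_inv (lower_central_comm cuv hb).
apply: lower_central_eq h.
rewrite !winv_cat !winvK -!catA.
have h1 := group_eq_cancelr (winv u ++ winv a ++ u ++ winv v) (a ++ u ++ winv
  u ++ v) hu.
have h2 := group_eq_cancelr (winv u ++ winv a ++ u ++ winv v ++ a) v hu.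
by rewrite -!catA in h1 h2; exact: group_eq_trans h1 h2.
Qed.

(** Milnor's algorithm: an arc is the conjugate of the meridian of its component
    by the undercrossings met before it, in which the arcs passing over are
    rewritten in turn. Each round is correct one term deeper in the lower central
    series, by [cong_conj]. *)
Fixpoint milnor_word (q : nat) (a : Defs.arc) : seq (nat * bool) :=
  if q is q'.+1 then
    let l := flatten [seq if l.2 then milnor_word q' l.1
                          else formal_inverse (milnor_word q' l.1)
                         | l <- take a.2 (longitude L a.1)] in
    formal_inverse l ++ (a.1, true) :: l
  else [:: (a.1, true)].

Definition milnor_subst q (w : word) : seq (nat * bool) :=
  flatten [seq if l.2 then milnor_word q l.1
               else formal_inverse (milnor_word q l.1) | l <- w].

Lemma meridian_word_cat u v :
  meridian_word (u ++ v) = meridian_word u ++ meridian_word v.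
Proof. exact: map_cat. Qed.

Lemma meridian_word_inverse w :
  meridian_word (formal_inverse w) = winv (meridian_word w).
Proof. by rewrite /winv /meridian_word /formal_inverse map_rev -!map_comp. Qed.

Lemma milnor_subst_cong q w : is_word L w ->
  (forall a, is_arc L a ->
     cong q.+1 [:: (a, true)] (meridian_word (milnor_word q a))) ->
  cong q.+1 w (meridian_word (milnor_subst q w)).
Proof.
move=> hw ha; elim: w hw => [_|[a e] w IH /= /andP[aa /IH{}IH]].
  by apply: group_eq_cong => //; exact: group_eq_refl.
rewrite -(cat1s (a, e) w) /milnor_subst [flatten _]/= meridian_word_cat;
  apply: cong_cat => //.
case: e => /=; first exact: ha.
by rewrite meridian_word_inverse; apply: (cong_winv _ (ha a aa)).
Qed.

Lemma longitude_split j s1 s2 : td_strand L j = s1 ++ s2 ->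
  take (nunder (L := L) s1) (longitude L j)
    = [seq (over_arc p.1, td_pos L p.1) | p <- s1 & ~~ p.2].
Proof.
by move=> es; rewrite /longitude es filter_cat map_cat take_size_cat // size_map
  size_filter.
Qed.

Lemma is_word_longitude j : is_word L (longitude L j).
Proof. by apply/allP => _ /mapP[p _ ->]; exact: is_arc_over. Qed.

Lemma group_eq_arc i s1 s2 : i \in td_labels L -> td_strand L i = s1 ++ s2 ->
  [:: ((i, nunder (L := L) s1), true)] ~
    winv (take (nunder (L := L) s1) (longitude L i)) ++ [:: ((i, 0%N), true)]
      ++ take (nunder (L := L) s1) (longitude L i).
Proof.
move=> iL; elim/last_ind: s1 s2 => [|s1 [x b] IH] s2 es.
  by rewrite take0; exact: group_eq_refl.
move: (es); rewrite cat_rcons => es'; have {}IH := IH _ es'.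
rewrite (longitude_split es); rewrite (longitude_split es') in IH.
have -> : nunder (L := L) (rcons s1 (x, b)) = (nunder (L := L) s1 + ~~ b)%N.
  by rewrite /nunder -cats1 count_cat /= addn0.
rewrite -cats1 filter_cat map_cat [filter _ [:: _]]/=;
  case: b es es' => es es' /=.
  by rewrite cats0 addn0; exact: IH.
rewrite addn1; apply: group_eq_trans (group_eq_wirtinger [::] [::] iL es') _.
rewrite winv_cat -!catA; have := group_eq_ctx [:: (over_arc x, ~~ td_pos L x)]
  [:: (over_arc x, td_pos L x)] IH.
by rewrite -!catA.
Qed.

Lemma milnor_word_cong q a : is_arc L a ->
  cong q.+1 [:: (a, true)] (meridian_word (milnor_word q a)).
Proof.
elim: q a => [|q IH] a ha.
  have h0 : is_arc L (a.1, 0%N) by case/andP: ha => h _; rewrite /is_arc h.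
  by split; rewrite /= ?ha ?h0 //; apply: lower_central_top; rewrite /= ha h0.
case: a ha => i t ha; have /andP[iL /= let'] := ha.
have [s1 [s2 [es et]]] := nunder_split let'.
have h := group_eq_arc iL es; rewrite et in h.
apply: cong_trans (group_eq_cong _ _ h) _ => //; first by rewrite /= ha.
set l := take t (longitude L i).
have wl : is_word L l.
  have := is_word_longitude i; rewrite -(cat_take_drop t (longitude L i)).
  by rewrite is_word_cat => /andP[].
have wm : is_word L [:: ((i, 0%N), true)] by rewrite /= /is_arc iL.
rewrite -/(milnor_subst q l) meridian_word_cat meridian_word_inverse.
exact: cong_conj wm (milnor_subst_cong wl IH).
Qed.

Lemma milnor_exists J j : j \in td_labels L -> exists v, is_milnor L J j v.
Proof.
move=> jL; pose w := milnor_subst (size J) (longitude L j).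
exists (magnus w J), (size J).+1, w; split=> //.
  have [_ h _] := milnor_subst_cong (is_word_longitude j) (milnor_word_cong
    (size J)).
  apply/allP => l hl; have := allP h ((l.1, 0%N), l.2); rewrite /is_arc /=.
  by case/(_ _)/andP => //; apply/mapP; exists l.
have [h1 h2 h3] := milnor_subst_cong (is_word_longitude j) (milnor_word_cong
  (size J)).
by have := lower_central_inv h3; rewrite winv_cat winvK.
Qed.

(** Milnor invariants are well defined: a word in a deep term of the lower
    central series has a trivial matrix. *)
Lemma milnor_word_mx I j (a b : 'I_((size I).+1)) : uniq I ->
  j \in td_labels L -> (a <= b)%N ->
  milnor L (subword I a b) j = word_mx L I (longitude L j) a b.
Proof.
move=> uI jL le; rewrite /milnor.
have /(epsilon_spec (inhabits 0%R)) := milnor_exists (subword I a b) jL.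
move: (epsilon _ _) => _ [q [w [ltq _ hlc ->]]].
have := lower_central_mx wfL uI hlc; rewrite word_mx_cat.
set M' := word_mx _ _ (winv _); pose M := word_mx L I (meridian_word w).
set X := word_mx _ _ (longitude L j) => h.
rewrite -(@word_mx_magnus L) // -/M; apply/eqP; rewrite eq_sym -subr_eq0.
have -> : X a b - M a b = (X - M) a b by rewrite !mxE.
have -> : X - M = M * (M' * X - 1).
  by rewrite mulrBr mulr1 mulrA /M /M' word_mx_winv_r // mul1r.
have oM : order_ge 0 M by exact: order_ge_word_mx.
rewrite (order_geMl oM h) //.
by move: ltq; rewrite size_subword ?ltn_subLR // -ltnS; exact: ltn_ord.
Qed.

(** A crossing of [j] under itself adds only words containing [j]. *)
Lemma milnor_expansion I j (a b : 'I_((size I).+1)) : uniq I ->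
  j \in td_labels L -> (a <= b)%N -> j \notin subword I a b ->
  milnor L (subword I a b) j
    = strand_expansion I (positive_word (td_strand L j)) a b.
Proof.
move=> uI jL le nj; rewrite milnor_word_mx // strand_expansion_under.
suff [_ _ ->] : agree (window a b) (word_mx L I (longitude L j))
    (strand_expansion (L := L) I (positive_word (under (td_strand L j)))) => //.
  by rewrite /window !leqnn.
rewrite /longitude -/(under _).
have : all (fun p => (p \in td_strand L j) && ~~ p.2) (under (td_strand L j)).
  by apply/allP => p; rewrite mem_filter andbC.
elim: (under _) => [_|[x b'] s IH] /=.
  by rewrite word_mx_nil /strand_expansion expansion_nil;
    exact/agree_refl/order_ge1.
case/andP=> /andP[px /= nb'] /IH{}IH.
rewrite -cat1s word_mx_cat word_mx_seq1 /strand_expansion expansion_cons.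
apply: agreeM => //; first exact: window_closed.
rewrite /arc_mx /=; apply: agreeD; first exact/agree_refl/order_ge1.
rewrite (negPf nb') in px *; rewrite /pass_sign /= expr0 mul1r; apply: agreeZ.
rewrite arc_conjugate_over // /over_label /opposite (pass_labelE wfL jL px) /=.
case: eqP => [e|_]; last by apply/agree_refl/order_geW;
  [|exact: order_ge_conjugate_letter].
have hn o : agree (window a b) (letter_mx I o) 0 ->
  agree (window a b) (conjugate_letter I (@pass_sign L) (@over_label L)
    (@over_word L) o (over_word (x, false))) 0.
  by move=> ho; apply: agree_prod0 => //;
    [exact: window_closed|exact: order_ge_expansion..].
apply: agree_trans (hn _ _) _; first by rewrite e; apply: letter_mx_window.
by apply/agree_sym/hn; rewrite letter_mx_none; apply: agree_refl;
  exact: order_ge00.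
Qed.

End MilnorAlgorithm.

(** * Resolutions of the double points *)

Section Resolution.
Variable L : tangle_diagram.
Hypothesis wfL : gauss_wf L.

Local Notation pass := ('I_(td_ncross L) * bool)%type.

Implicit Types (A : {set 'I_(td_ncross L)}) (p : pass).

Definition resolve_pass A p : pass := (p.1, p.2 (+) (p.1 \in td_double L :&: A)).

Lemma resolve_passK A : involutive (resolve_pass A).
Proof. by move=> [x b]; rewrite /resolve_pass /= addbK. Qed.

Lemma resolve_strand A i :
  td_strand (resolve A) i = map (resolve_pass A) (td_strand L i).
Proof. by []. Qed.

Lemma gauss_wf_resolve A : gauss_wf (resolve A).
Proof.
case/andP: wfL => uL pL; rewrite /gauss_wf uL /=.
have -> : [seq td_strand (resolve A) i | i <- td_labels L]
    = map (map (resolve_pass A)) [seq td_strand L i | i <- td_labels L].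
  by rewrite -map_comp.
rewrite -map_flatten; apply: perm_trans (perm_map _ pL) _.
apply: uniq_perm; rewrite ?enum_uniq //.
  by rewrite map_inj_uniq ?enum_uniq //; exact: inv_inj (resolve_passK A).
move=> p; rewrite mem_enum; apply/mapP; exists (resolve_pass A p).
  by rewrite mem_enum.
by rewrite resolve_passK.
Qed.

Lemma pass_label_resolve A p :
  pass_label (L := resolve A) (resolve_pass A p) = pass_label p.
Proof.
apply: pass_labelE; first exact: gauss_wf_resolve.
  exact: pass_label_labels.
by rewrite resolve_strand; apply/map_f/mem_pass_label.
Qed.

Lemma passes_before_resolve A p :
  passes_before (L := resolve A) (resolve_pass A p)
    = map (resolve_pass A) (passes_before p).
Proof.
have [s2 es] := strand_split wfL p.
apply: (@strand_split_before (resolve A) (gauss_wf_resolve A) (pass_label p)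
         _ _ (map (resolve_pass A) s2)); first exact: pass_label_labels.
by rewrite resolve_strand es map_cat.
Qed.

Lemma opposite_resolve A p :
  opposite (L := resolve A) (resolve_pass A p) = resolve_pass A (opposite p).
Proof. by rewrite /opposite /resolve_pass /= addNb. Qed.

Lemma over_label_resolve A p :
  over_label (L := resolve A) (resolve_pass A p) = over_label p.
Proof. by rewrite /over_label opposite_resolve !pass_label_resolve. Qed.

Lemma strand_expansion_resolve I A s :
  strand_expansion (L := resolve A) I (positive_word (map (resolve_pass A) s))
    = expansion I (fun p => pass_sign (L := resolve A) (resolve_pass A p))
        (@over_label L) (@over_word L) (positive_word s).
Proof.
pose P : rel nat := fun _ _ => true.
pose phi p : option pass := Some (resolve_pass A p).
have htr (t : seq pass) : transport phi (fun=> false) (positive_word t)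
    = positive_word (map (resolve_pass A) t).
  by elim: t => //= p t IH; rewrite /transport /=; congr (_ :: _); exact: IH.
have [] := @expansion_transport I pass pass
  (fun p => pass_sign (L := resolve A) (resolve_pass A p))
  (@pass_sign (resolve A)) (@over_label L) (@over_label (resolve A))
  (@over_word L) (@over_word (resolve A)) P phi (fun=> false) predT _ _
  (positive_word s).
- by [].
- move=> p _ /=; right; split; rewrite ?over_label_resolve ?expr0 ?mul1r //.
    by apply/allP.
  by rewrite /over_word htr opposite_resolve passes_before_resolve.
- by apply/allP.
move=> _ _ h; rewrite htr in h; apply/matrixP => a b.
by rewrite /strand_expansion -h.
Qed.

Lemma pass_sign_resolve A p :
  pass_sign (L := resolve A) (resolve_pass A p) =
    if p.1 \in td_double L then
      if p.1 \in A then (if p.2 then -1 else 0) else (if p.2 then 0 else 1)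
    else pass_sign p.
Proof.
rewrite /pass_sign /resolve_pass /= inE.
case: (p.1 \in td_double L); case: (p.1 \in A); case: p.2 => //=.
Qed.

(** Each double point contributes [1] whichever of its two strands passes over,
    and a top difference sees nothing else. *)
Lemma milnor_singular_poly I j (a b : 'I_((size I).+1)) l :
  uniq I -> j \in td_labels L -> (a <= b)%N -> j \notin subword I a b ->
  (b - a)%N = #|td_double L| ->
  all (fun c : int * seq pass => size c.2 <= b - a)%N l ->
  (forall y, expansion I y (@over_label L) (@over_word L)
               (positive_word (td_strand L j)) a b = poly_eval l y) ->
  milnor_singular L (subword I a b) j
    = \sum_(c <- l | perm_eq (map fst c.2) (enum (td_double L))) c.1.
Proof.
move=> uI jL le nj sz hl el; rewrite sz in hl.
have := @alternating_sum_poly _ (td_double L) _ (fun p : pass => p.1)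
  (fun A p => pass_sign (L := resolve A) (resolve_pass A p)) (@pass_sign L)
  (fun p => if p.2 then -1 else 0) (fun p => if p.2 then 0 else 1) l
  pass_sign_resolve hl.
have -> : \sum_(c <- l | perm_eq [seq p.1 | p <- c.2] (enum (td_double L)))
    c.1 * monomial c.2 (fun p => (if p.2 then 0 else 1) - (if p.2 then -1 else 0))
  = \sum_(c <- l | perm_eq [seq p.1 | p <- c.2] (enum (td_double L))) c.1.
  by apply: eq_bigr => c _; rewrite /monomial big1 ?mulr1 // => p _; case: p.2.
move=> <-; rewrite /milnor_singular; apply: eq_bigr => A _; congr (_ * _).
rewrite milnor_expansion //; last exact: gauss_wf_resolve.
by rewrite resolve_strand strand_expansion_resolve.
Qed.

End Resolution.

(** * Weight systems as differences of expansions of chord diagrams *)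

Lemma uniq_map_inj_in (T U : eqType) (f : T -> U) s :
  uniq (map f s) -> {in s &, injective f}.
Proof.
elim: s => //= a s IH /andP[nfa us] x z; rewrite !inE.
case/predU1P=> [->|xs] /predU1P[->|zs] // e; last exact: IH.
  by rewrite e map_f in nfa.
by rewrite -e map_f in nfa.
Qed.

Section ChordExpansion.
Variable D : chord_diagram.

(** A chord endpoint [(x, i)] on the component [i] is read as an undercrossing
    under the component of the other endpoint of [x]. *)
Definition chord_label (h : nat * nat) : option nat :=
  ohead [seq t <- cd_labels D | (t != h.2) && (h.1 \in cd_code D t)].

Definition component_word (t : nat) (s : seq nat) : seq (nat * nat * bool) :=
  [seq ((z, t), true) | z <- s].

Definition chord_word (h : nat * nat) : seq (nat * nat * bool) :=
  if chord_label h is Some t then component_word t (before h.1 (cd_code D t))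
  else [::].

Definition chord_expansion I (y : nat -> int) :=
  expansion I (fun h : nat * nat => y h.1) chord_label chord_word.

Section Representation.
Variables (L : tangle_diagram) (f : 'I_(td_ncross L) -> nat).
Hypotheses (wfL : gauss_wf L) (wfD : cd_wf D).
Hypothesis labelsL : perm_eq (td_labels L) (cd_labels D).
Hypothesis chordsL : perm_eq [seq f x | x <- enum (td_double L)] (cd_chords D).
Hypothesis codeL : {in cd_labels D, forall i,
  [seq f p.1 | p <- td_strand L i & p.1 \in td_double L] = cd_code D i}.

Local Notation pass := ('I_(td_ncross L) * bool)%type.

Lemma double_inj : {in td_double L &, injective f}.
Proof.
have uc : uniq [seq f x | x <- enum (td_double L)].
  by rewrite (perm_uniq chordsL); case/and3P: wfD.
by move=> x z xd zd; apply: (uniq_map_inj_in uc); rewrite mem_enum.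
Qed.

Lemma card_double : #|td_double L| = size (cd_chords D).
Proof. by rewrite -(perm_size chordsL) size_map -cardE. Qed.

Lemma uniq_cd_labels : uniq (cd_labels D).
Proof. by case/and3P: wfD. Qed.

Lemma mem_code i p : i \in cd_labels D -> p.1 \in td_double L ->
  (f p.1 \in cd_code D i) = (i == pass_label p) || (i == pass_label (opposite p)).
Proof.
move=> iD pd; have iL : i \in td_labels L by rewrite (perm_mem labelsL).
rewrite -codeL //; apply/mapP/orP => [[r]|[]/eqP->].
- rewrite mem_filter => /andP[rd ri] /(double_inj pd rd) e.
  rewrite -(pass_labelE wfL iL ri).
  have [->|->] : r = p \/ r = opposite p.
    case: r p {pd rd ri} e => [x b] [x' b'] /= -> ; rewrite /opposite /=.
    by case: b b' => [] []; [left|right|right|left].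
  - by left.
  - by right.
- by exists p; rewrite // mem_filter pd mem_pass_label.
- by exists (opposite p); rewrite // mem_filter pd mem_pass_label.
Qed.

Lemma chord_label_pass p : p.1 \in td_double L ->
  chord_label (f p.1, pass_label p) = over_label p.
Proof.
move=> pd; rewrite /chord_label /= /over_label.
rewrite (@eq_in_filter _ _ (fun t => (t != pass_label p) && (t == pass_label
  (opposite p)))).
  case: eqP => [->|/eqP ne].
    by rewrite (eq_filter (a2 := pred0)) ?filter_pred0 // => t /=; case: eqP.
  rewrite (eq_filter (a2 := pred1 (pass_label (opposite p)))); last first.
    by move=> t /=; case: (t =P pass_label (opposite p)) => [->|_];
      rewrite ?ne ?andbF.
  rewrite filter_pred1_uniq ?uniq_cd_labels //.
  by rewrite -(perm_mem labelsL) pass_label_labels.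
by move=> t tD; rewrite mem_code //; case: (t == pass_label p).
Qed.

Definition double_head p : option (nat * nat) :=
  if p.1 \in td_double L then Some (f p.1, pass_label p) else None.

Lemma transport_double t s : t \in td_labels L -> {subset s <= td_strand L t} ->
  transport double_head (fun=> false) (positive_word s)
    = component_word t [seq f p.1 | p <- s & p.1 \in td_double L].
Proof.
move=> tL; elim: s => //= p s IH sub.
have {}IH := IH (fun r rs => sub r (mem_behead (s := p :: s) rs)).
rewrite /transport /= /double_head; case: ifP => pd /=.
  rewrite (pass_labelE wfL tL (sub p (mem_head _ _))) /=.
  by congr (_ :: _); exact: IH.
exact: IH.
Qed.

Lemma chord_word_pass p t : p.1 \in td_double L -> over_label p = Some t ->
  chord_word (f p.1, pass_label p)
    = transport double_head (fun=> false) (over_word p).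
Proof.
move=> pd ot; rewrite /chord_word chord_label_pass // ot /=.
move: ot; rewrite /over_label; case: eqP => // /eqP ne [<-] {t}.
have tL : pass_label (opposite p) \in td_labels L by exact: pass_label_labels.
have [s2 es] := strand_split wfL (opposite p).
rewrite /over_word (transport_double tL); last by move=> r; exact: mem_take.
congr component_word;
  rewrite -codeL -?(perm_mem labelsL) // es filter_cat map_cat /=.
rewrite pd /= /before index_cat ifN /=; last first.
  apply/mapP => -[r]; rewrite mem_filter => /andP[rd rs] /(double_inj pd rd) e.
  have rt : r \in td_strand L (pass_label (opposite p)) by exact: mem_take rs.
  have [er|er] : r = p \/ r = opposite p.
    case: r p {pd rd rs rt ne tL s2 es} e => [x b] [x' b'] /= ->;
      rewrite /opposite /=.
    by case: b b' => [] []; [left|right|right|left].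
    by move: ne; rewrite -(pass_labelE wfL tL rt) er eqxx.
  have := count_strand wfL (opposite p); rewrite (big_rem _ tL) /= es.
  rewrite count_cat /= eqxx; move: rs; rewrite er -has_pred1 has_count.
  by move: (count_mem _ (passes_before _)) (count_mem _ s2) (\sum_(_ <- _)
    _)%N => a b d; lia.
by rewrite eqxx addn0 take_size_cat // size_map.
Qed.

(** The ordinary crossings of the tangle are given the value [0]. *)
Lemma chord_expansion_strand I y j : j \in cd_labels D ->
  chord_expansion I y (component_word j (cd_code D j))
    = expansion I (fun p : pass => (p.1 \in td_double L)%:R * y (f p.1))
        (@over_label L) (@over_word L) (positive_word (td_strand L j)).
Proof.
move=> jD; have jL : j \in td_labels L by rewrite (perm_mem labelsL).
pose P : rel nat := fun _ _ => true.
have [] := @expansion_transport I _ _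
  (fun p : pass => (p.1 \in td_double L)%:R * y (f p.1))
  (fun h : nat * nat => y h.1) (@over_label L) chord_label
  (@over_word L) chord_word P double_head (fun=> false) predT _ _
  (positive_word (td_strand L j)).
- by [].
- move=> p _; rewrite /double_head; case: ifP => pd /=; last first.
    by left; rewrite /= pd mul0r.
  case eo: (over_label p) => [t|]; [right|left].
    split; rewrite ?chord_label_pass ?expr0 ?pd ?mul1r //; first by apply/allP.
    exact: chord_word_pass eo.
  by split; right; rewrite ?chord_label_pass // eo letter_mx_none;
    apply: agree_refl; exact: order_ge00.
- by apply/allP.
move=> _ _ h; rewrite (transport_double jL) // codeL // in h.
by apply/matrixP => a b; rewrite h.
Qed.

Lemma milnor_singular_difference I j (a b : 'I_((size I).+1)) :
  uniq I -> j \in cd_labels D -> (a <= b)%N -> j \notin subword I a b ->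
  cd_degree D = (b - a)%N ->
  milnor_singular L (subword I a b) j
    = difference (cd_chords D)
        (fun y => chord_expansion I y (component_word j (cd_code D j)) a b)
        (fun=> 0).
Proof.
move=> uI jD le nj deg; have jL : j \in td_labels L by rewrite (perm_mem labelsL).
have := @graded_expansion I _ (@over_label L) (@over_word L)
  (positive_word (td_strand L j)) a b.
rewrite le => -[l hl el].
rewrite (milnor_singular_poly wfL uI jL le nj _ hl el); last first.
  by rewrite card_double -deg.
have uc : uniq (cd_chords D) by case/and3P: wfD.
have hl' : all (fun c : int * seq pass => size c.2 <= size (cd_chords D))%N l.
  by rewrite -/(cd_degree D) deg.
rewrite (eq_difference (g := fun y => poly_eval l
    (fun p : pass => (p.1 \in td_double L)%:R * y (f p.1)))); last first.
  by move=> y _; rewrite chord_expansion_strand.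
rewrite (difference_poly (fun p : pass => f p.1)
  (fun p : pass => (p.1 \in td_double L)%:R) _ uc hl').
rewrite [LHS]big_mkcond [RHS]big_mkcond /=; apply: eq_bigr => -[c m] _ /=.
have [dm|] := boolP (all (fun p : pass => p.1 \in td_double L) m); last first.
  rewrite -has_predC => /hasP[p pm /= npd].
  have -> : monomial m (fun p : pass => (p.1 \in td_double L)%:R) = 0.
    by rewrite /monomial (perm_big _ (perm_to_rem pm)) big_cons /= (negPf npd)
      mul0r.
  rewrite mulr0 if_same; case: ifP => // /perm_mem/(_ p.1).
  by rewrite mem_enum (negPf npd) map_f.
have -> : monomial m (fun p : pass => (p.1 \in td_double L)%:R) = 1.
  by rewrite /monomial big_seq big1 // => p /(allP dm) ->.
rewrite mulr1; congr (if _ then _ else _).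
have -> : [seq f p.1 | p <- m] = map f [seq p.1 | p <- m] by rewrite -map_comp.
rewrite -(permPr chordsL); apply/idP/idP => [|pm]; first exact: perm_map.
have um : uniq [seq p.1 | p <- m].
  by apply: (map_uniq (f := f)); rewrite (perm_uniq pm) (perm_uniq chordsL).
have sub : {subset [seq p.1 | p <- m] <= enum (td_double L)}.
  by move=> x /mapP[p /(allP dm) pd ->]; rewrite mem_enum.
have [|_ em] := uniq_min_size um sub.
  by have := perm_size pm; rewrite !size_map => ->.
by apply: uniq_perm => //; exact: enum_uniq.
Qed.

End Representation.
End ChordExpansion.

Lemma is_tangle_gauss_wf L : is_tangle L -> gauss_wf L.
Proof. by case/and4P=> uL pL _ _; apply/andP. Qed.

(** The weight system of a Milnor invariant is computed on the chord diagram
    alone: it does not depend on the singular tangle. *)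
Lemma weight_difference S D I j (a b : 'I_((size I).+1)) :
  representatives S -> cd_wf D -> uniq I -> j \in cd_labels D -> (a <= b)%N ->
  j \notin subword I a b -> cd_degree D = (b - a)%N ->
  weight S (subword I a b) j D
    = difference (cd_chords D)
        (fun y => chord_expansion D I y (component_word j (cd_code D j)) a b)
        (fun=> 0).
Proof.
move=> HS wfD uI jD le nj deg.
have [tL [labelsL [f [chordsL codeL]]]] := HS D wfD.
exact: (milnor_singular_difference (is_tangle_gauss_wf tL) wfD labelsL chordsL
  codeL).
Qed.


(** * Cutting a chord diagram *)

Section WellFormed.
Variable D : chord_diagram.
Hypothesis wfD : cd_wf D.

Lemma count_code x :
  (\sum_(i <- cd_labels D) count_mem x (cd_code D i) = (x \in cd_chords D) * 2)%N.
Proof.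
case/and3P: wfD => _ uc /permP/(_ (pred1 x)).
rewrite count_flatten -map_comp sumnE big_map => ->.
by rewrite count_cat count_uniq_mem // addnn muln2.
Qed.

Lemma mem_code_chords x i :
  i \in cd_labels D -> x \in cd_code D i -> x \in cd_chords D.
Proof.
move=> iD xi; have := count_code x; rewrite (big_rem i) //=.
move: xi; rewrite -has_pred1 has_count; case: (x \in cd_chords D) => //.
by rewrite mul0n; case: (count_mem _ _).
Qed.

Lemma chord_labelP h t : chord_label D h = Some t ->
  [/\ t \in cd_labels D, t != h.2 & h.1 \in cd_code D t].
Proof.
rewrite /chord_label; set s := filter _ _ => e.
have : t \in s by case: s e => //= z s [->]; rewrite mem_head.
by rewrite mem_filter => /andP[/andP[]].
Qed.

Lemma chord_ends x i t : i \in cd_labels D -> t \in cd_labels D -> i != t ->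
  x \in cd_code D i -> x \in cd_code D t ->
  count_mem x (cd_code D i) = 1%N /\
  forall r, r \in cd_labels D -> x \in cd_code D r -> (r == i) || (r == t).
Proof.
move=> iD tD ne xi xt; have uD : uniq (cd_labels D) by case/and3P: wfD.
have := count_code x; rewrite (mem_code_chords iD xi) (big_rem i) //=.
have tD' : t \in rem i (cd_labels D) by rewrite mem_rem_uniq // inE eq_sym ne.
rewrite (big_rem t) //= => e.
move: xi xt; rewrite -!has_pred1 !has_count => xi xt.
split; first by move: e xi xt;
  move: (count_mem _ _) (count_mem _ _) (\sum_(_ <- _) _)%N => a b d; lia.
move=> r rD xr; apply: contraT; rewrite negb_or => /andP[ri rt].
have rD' : r \in rem t (rem i (cd_labels D)).
  by rewrite mem_rem_uniq ?rem_uniq // inE rt mem_rem_uniq // inE ri.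
move: e xi xt xr; rewrite (big_rem r) //= -has_pred1 has_count.
by move: (count_mem _ _) (count_mem _ _) (count_mem _ _) (\sum_(_ <- _) _)%N =>
  a b d f; lia.
Qed.

Lemma chord_label_ends x i t :
  i \in cd_labels D -> t \in cd_labels D -> i != t ->
  x \in cd_code D i -> x \in cd_code D t -> chord_label D (x, i) = Some t.
Proof.
move=> iD tD ne xi xt; have [_ ends] := chord_ends iD tD ne xi xt.
have uD : uniq (cd_labels D) by case/and3P: wfD.
rewrite /chord_label (@eq_in_filter _ _ (pred1 t)) ?filter_pred1_uniq // => r rD
  /=.
apply/andP/eqP => [[ri xr]|->]; last by rewrite eq_sym.
by have := ends r rD xr; rewrite (negPf ri) => /eqP.
Qed.

End WellFormed.

Lemma before_filter (C : pred nat) x s : C x ->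
  before x (filter C s) = filter C (before x s).
Proof.
move=> Cx; rewrite /before; elim: s => //= z s IH.
have [->|ne] := eqVneq z x; first by rewrite Cx /= eqxx.
by case Cz: (C z); rewrite /= ?(negPf ne) /= Cz ?IH.
Qed.

Lemma cat_before_after x s : x \in s -> s = before x s ++ x :: after x s.
Proof.
move=> xs; rewrite -{1}(cat_take_drop (index x s) s) (drop_nth x) ?index_mem //.
by rewrite nth_index.
Qed.

Lemma poly_le_comp (H C : eqType) (g : H -> C) d f :
  poly_le d f -> poly_le d (fun y => f (fun h => y (g h))).
Proof.
case=> l hl el; exists [seq (c.1, map g c.2) | c <- l].
  by rewrite all_map; apply: sub_all hl => c /=; rewrite size_map.
move=> y; rewrite el /poly_eval big_map; apply: eq_bigr => c _.
by rewrite /monomial big_map.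
Qed.

Lemma poly_le_chord_expansion D I w (a b : 'I_((size I).+1)) : (a <= b)%N ->
  poly_le (b - a) (fun y => chord_expansion D I y w a b).
Proof.
move=> le; have := @graded_expansion I _ (chord_label D) (chord_word D) w a b.
by rewrite le => /(poly_le_comp fst).
Qed.

Lemma expansion_diag I (H : Type) e cmp pre (w : seq (H * bool)) a :
  expansion I e cmp pre w a a = 1.
Proof.
suff h : order_ge 1 (expansion I e cmp pre w - 1).
  have := h a a; rewrite !mxE eqxx addn1 ltnSn => /(_ isT)/eqP.
  by rewrite subr_eq0 => /eqP.
elim: w => [|[x b] w IH]; first by rewrite expansion_nil subrr; exact: order_ge00.
rewrite expansion_cons -[X in _ - X]mulr1; apply: order_ge_subM => //.
- exact: order_ge1.
- exact: order_ge_expansion.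
- by rewrite addrAC subrr add0r; apply: order_geZ;
  exact: order_ge_conjugate_letter.
Qed.

Section Windows.
Variables (W : pred nat) (I : seq nat) (a b : 'I_((size I).+1)).
Hypothesis subW : {subset subword I a b <= W}.

Lemma null_chord D (y : nat -> int) h :
  (forall t, chord_label D h = Some t -> W t -> False) ->
  null I (window a b) (fun h : nat * nat => y h.1) (chord_label D) h.
Proof.
move=> hn; right; apply: letter_mx_window.
case e: (chord_label D h) => [t|] //.
by apply/negP => /subW; exact: hn e.
Qed.

Lemma chord_label_cases D h :
  (exists t, chord_label D h = Some t /\ W t) \/
  (forall t, chord_label D h = Some t -> W t -> False).
Proof.
case: (chord_label D h) => [t|]; last by right.
case Wt: (W t); first by left; exists t.
by right=> r [<-]; rewrite Wt.
Qed.

(** An expansion only involves the chords through which the recursion passes. *)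
Lemma chord_expansion_depends D (good : pred (nat * nat)) (p : pred nat) w :
  (forall h t, good h -> chord_label D h = Some t -> W t ->
     p h.1 && all good (unzip1 (chord_word D h))) ->
  all good (unzip1 w) -> (a <= b)%N ->
  depends_on p (fun y => chord_expansion D I y w a b).
Proof.
move=> hp hw le y y' e.
have tr v : transport (fun h : nat * nat => Some h) (fun=> false) v = v.
  by elim: v => //= -[h d] v IH; rewrite /transport /= addbF; congr (_ :: _).
have [] := @expansion_transport I _ _ (fun h : nat * nat => y h.1)
  (fun h : nat * nat => y' h.1) (chord_label D) (chord_label D)
  (chord_word D) (chord_word D) (window a b) (fun h : nat * nat => Some h)
  (fun=> false) good _ _ w hw.
- exact: window_closed.
- move=> h gh; have [[t [ht Wt]]|hn] := chord_label_cases D h.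
    case/andP: (hp h t gh ht Wt) => ph gw.
    by right; split; rewrite ?expr0 ?mul1r ?tr // (e _ ph).
  by left; split; exact: null_chord.
move=> _ _ h; rewrite tr in h; rewrite /chord_expansion h //.
by rewrite /window !leqnn.
Qed.

End Windows.

Section Cut.
(** The components [k] and [N] are cut into the parts [U] and [V], which are
    joined into a component [s] that replaces them; [W] is a set of other
    components, and only the chords in [C] are kept. *)
Variables (D : chord_diagram) (k N : nat) (W : pred nat) (U V : seq nat).
Hypothesis wfD : cd_wf D.
Hypotheses (kD : k \in cd_labels D) (ND : N \in cd_labels D) (kN : k != N).
Hypotheses (Wk : W k = false) (WN : W N = false).
Hypotheses (subU : {subset U <= cd_code D k}) (subV : {subset V <= cd_code D N}).

Definition region (h : nat * nat) : bool :=
  [|| (h.2 == k) && (h.1 \in U), (h.2 == N) && (h.1 \in V)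
    | [&& W h.2, h.2 \in cd_labels D & h.1 \in cd_code D h.2]].

Lemma region_code h : region h ->
  (h.2 \in cd_labels D) && (h.1 \in cd_code D h.2).
Proof.
case/or3P=> [/andP[/eqP-> /subU->]|/andP[/eqP-> /subV->]|/and3P[_ -> ->]] //.
  by rewrite kD.
by rewrite ND.
Qed.

Definition inner (h : nat * nat) (t : nat) : Prop :=
  [/\ region h, W t & chord_label D h = Some t].

Lemma inner_ends x i t : inner (x, i) t ->
  [/\ i \in cd_labels D, t \in cd_labels D, i != t, x \in cd_code D i
    & x \in cd_code D t].
Proof.
case=> /region_code/=/andP[iD xi] _ /chord_labelP/=[tD ti xt].
by split=> //; rewrite eq_sym.
Qed.

Lemma region_component_word t s : t \in cd_labels D -> W t ->
  {subset s <= cd_code D t} -> all region (unzip1 (component_word t s)).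
Proof.
move=> tD Wt sub; rewrite /component_word /unzip1 -map_comp all_map.
by apply/allP => z /sub zt /=; rewrite /region /= Wt tD zt !orbT.
Qed.

Lemma chord_word_inner x i t : inner (x, i) t ->
  chord_word D (x, i) = component_word t (before x (cd_code D t)).
Proof. by case=> _ _ e; rewrite /chord_word e. Qed.

Lemma region_chord_word h t : inner h t -> all region (unzip1 (chord_word D h)).
Proof.
case: h => x i ht; have [_ tD _ _ _] := inner_ends ht.
rewrite (chord_word_inner ht); apply: region_component_word => //.
  by case: ht.
by move=> z; exact: mem_take.
Qed.

Variables (I : seq nat) (a b : 'I_((size I).+1)).
Hypothesis subW : {subset subword I a b <= W}.

(** An endpoint of [x] on [k] lies outside [U] if [x] is not in [U], or if [x] has
    two endpoints on [k]; likewise for [N] and [V]. *)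
Definition removed (x : nat) : Prop :=
  [\/ x \in cd_code D k /\ (x \in U -> 1 < count_mem x (cd_code D k))%N,
      x \in cd_code D N /\ (x \in V -> 1 < count_mem x (cd_code D N))%N
    | exists i, [/\ i \in cd_labels D, x \in cd_code D i,
                    (i == k) || (i == N) = false & W i = false]].

(** Both endpoints of an inner chord survive the cut, and a chord has only two. *)
Lemma removed_inner x h t : removed x -> inner h t -> h.1 != x.
Proof.
case: h => z i rx iht; apply/negP => /eqP /= e; rewrite {z}e in iht.
have [iD tD it xi xt] := inner_ends iht.
have [ci ends] := chord_ends wfD iD tD it xi xt; have [rh Wt _] := iht.
case: rx => [[xk cU]|[xN cV]|[j [jD xj jkN Wj]]].
- case/orP: (ends k kD xk) => /eqP e; last by rewrite -e Wk in Wt.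
  case/or3P: rh => /= [/andP[_ /cU]|/andP[/eqP iN _]|/andP[Wi _]].
  + by rewrite e ci.
  + by move: kN; rewrite e iN eqxx.
  + by rewrite -e Wk in Wi.
- case/orP: (ends N ND xN) => /eqP e; last by rewrite -e WN in Wt.
  case/or3P: rh => /= [/andP[/eqP ik _]|/andP[_ /cV]|/andP[Wi _]].
  + by move: kN; rewrite e ik eqxx.
  + by rewrite e ci.
  + by rewrite -e WN in Wi.
- case/orP: (ends j jD xj) => /eqP e; last by rewrite -e Wj in Wt.
  by case/or3P: rh => /= [/andP[ik _]|/andP[iN _]|/andP[Wi _]];
    [rewrite e ik in jkN|rewrite e iN orbT in jkN|rewrite -e Wj in Wi].
Qed.

Section CutDiagram.
Variables (r s : nat) (C : seq nat) (newcode : seq nat) (rv : bool).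
Hypothesis hs : (s == k) && (r == N) || (s == N) && (r == k).
Hypothesis innerC : forall h t, inner h t -> h.1 \in C.
Hypothesis uC : uniq C.
Hypothesis subC : {subset C <= cd_chords D}.
Hypothesis countC : {in C, forall x,
  count_mem x newcode = (count_mem x (cd_code D k) + count_mem x (cd_code D
    N))%N}.

Definition cut : chord_diagram :=
  ChordDiagram [seq i <- cd_labels D | i != r] C
    (fun i => [seq x <- if i == s then newcode else cd_code D i | x \in C]).

Lemma wf_cut : cd_wf cut.
Proof.
have uD : uniq (cd_labels D) by case/and3P: wfD.
apply/and3P; split=> //=; first exact: filter_uniq.
apply/allP => x _ /=; apply/eqP.
rewrite count_cat (count_uniq_mem x uC) count_flatten -map_comp sumnE big_map.
have cf t : count_mem x [seq x <- t | x \in C] = ((x \in C) * count_mem x t)%N.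
  rewrite count_filter; case xC: (x \in C); rewrite ?mul1n ?mul0n.
    by apply: eq_count => z /=; case: eqP => // ->; rewrite xC.
  by rewrite -(count_pred0 t); apply: eq_count => z /=; case: eqP => // ->;
    rewrite xC.
under eq_bigr => i _ do rewrite /= cf.
rewrite -big_distrr /=; case xC: (x \in C); last by rewrite !mul0n.
rewrite mul1n big_filter.
have sr : s != r by case/orP: hs => /andP[/eqP-> /eqP->] //; rewrite eq_sym.
have sD : s \in cd_labels D by case/orP: hs => /andP[/eqP->].
have rD : r \in cd_labels D by case/orP: hs => /andP[_ /eqP->].
have urem : uniq (rem s (cd_labels D)) by exact: rem_uniq.
rewrite (big_rem s) //= sr eqxx countC //.
have := count_code wfD x; rewrite subC // mul1n (big_rem s) //= (big_rem r) /=;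
  last first.
  by rewrite mem_rem_uniq // inE eq_sym sr.
rewrite (rem_filter r urem) big_filter => e.
have -> : (\sum_(i <- rem s (cd_labels D) | i != r)
      count_mem x (if i == s then newcode else cd_code D i)
    = \sum_(i <- rem s (cd_labels D) | predC1 r i) count_mem x (cd_code D i))%N.
  rewrite -!(big_filter (rem s _)); apply: eq_big_seq => i.
  by rewrite mem_filter mem_rem_uniq // inE => /andP[_ /andP[/negPf-> _]].
move: e; case/orP: hs => /andP[/eqP-> /eqP->]; first by rewrite addnA => ->.
by rewrite addnCA addnA => ->.
Qed.

Definition cut_head (h : nat * nat) : option (nat * nat) :=
  if h.1 \in C then Some (h.1, if (h.2 == k) || (h.2 == N) then s else h.2)
  else None.

(** [rv] tells whether [U] is traversed backwards, which inverts its letters. *)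
Definition cut_sign (h : nat * nat) : bool := rv && (h.2 == k).

Lemma transport_component t v :
  transport cut_head cut_sign (component_word t v)
    = [seq ((z, if (t == k) || (t == N) then s else t), ~~ (rv && (t == k)))
          | z <- v & z \in C].
Proof.
elim: v => //= z v IH; rewrite /transport /= /cut_head /=.
by case: ifP => zC /=; rewrite -IH.
Qed.

Hypothesis newU : {subset U <= newcode}.
Hypothesis newV : {subset V <= newcode}.

(** Cutting does not change the expansion of a word in the region: a chord that is
    not inner is null both in [D] and in the cut diagram, and the inner ones have
    the same predecessors in both. *)
Lemma chord_expansion_cut (y y' : nat -> int) w :
  (forall x, y x = (-1) ^+ (rv && (x \in U)) * y' x) ->
  all region (unzip1 w) ->
  agree (window a b) (chord_expansion D I y w)
    (chord_expansion cut I y' (transport cut_head cut_sign w)).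
Proof.
move=> ey hw; apply: (expansion_transport (good := region)) => //.
  exact: window_closed.
have sr : s != r by case/orP: hs => /andP[/eqP-> /eqP->] //; rewrite eq_sym.
have sD : s \in cd_labels D by case/orP: hs => /andP[/eqP->].
have skN : (s == k) || (s == N) by case/orP: hs => /andP[/eqP-> _];
  rewrite eqxx ?orbT.
have rkN : (r == k) || (r == N) by case/orP: hs => /andP[_ /eqP->];
  rewrite eqxx ?orbT.
have WkN t : W t -> (t == k) || (t == N) = false.
  by move=> Wt; apply/negP => /orP[]/eqP e; rewrite e ?Wk ?WN in Wt.
case=> x i rh; rewrite /cut_head /=; case: ifPn => xC; last first.
  by apply: (null_chord subW) => t et Wt; case/negP: xC;
    apply: (innerC (h := (x, i)) (t := t)).
set i' := if _ then s else i.
have /andP[/= iD xi] := region_code rh.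
have [[t [ht Wt]]|hn] := chord_label_cases W D (x, i).
- right; have iht : inner (x, i) t by [].
  have [_ tD it _ xt] := inner_ends iht.
  have ts : t == s = false by apply/negP => /eqP e; rewrite -e (WkN t Wt) in skN.
  have tr : t != r by apply/negP => /eqP e; rewrite -e (WkN t Wt) in rkN.
  have e' : chord_label cut (x, i') = Some t.
    apply: (chord_label_ends wf_cut).
    + rewrite mem_filter /i'; case: ifP => ikN; first by rewrite sr.
      by rewrite iD andbT; apply/negP => /eqP e; rewrite e rkN in ikN.
    + by rewrite mem_filter tr.
    + by rewrite /i'; case: ifP => // _; rewrite eq_sym ts.
    + rewrite mem_filter xC /= /i'; case ikN: ((i == k) || (i == N)).
        rewrite eqxx; case/or3P: rh => /= [/andP[_ /newU]|/andP[_
          /newV]|/andP[Wi _]] //.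
        by rewrite WkN in ikN.
      by case: eqP => // e; rewrite e skN in ikN.
    + by rewrite mem_filter xC /= ts.
  split; rewrite ?ht ?e' //.
  + rewrite /= ey /cut_sign /=; congr ((-1) ^+ (nat_of_bool (rv && _)) * _).
    have [ik|ik] := eqVneq i k.
      case/or3P: rh => /= [/andP[_ ->]|/andP[/eqP e _]|/andP[Wi _]] //.
        by move: kN; rewrite -ik e eqxx.
      by rewrite ik Wk in Wi.
    apply/negP => /subU xk; have [_ ends] := chord_ends wfD iD tD it xi xt.
    case/orP: (ends k kD xk) => /eqP e; first by rewrite e eqxx in ik.
    by rewrite -e Wk in Wt.
  + exact: region_chord_word iht.
  + rewrite (chord_word_inner iht) transport_component WkN // /chord_word e' /=
    ts.
    rewrite (before_filter _ xC) /component_word.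
    have -> : rv && (t == k) = false.
      by case: (t =P k) => [e|_]; rewrite ?andbF //; rewrite e Wk in Wt.
    by [].
- left; split; first by apply: (null_chord subW) => t; exact: hn.
  apply: (null_chord subW) => t /chord_labelP[]/=;
    rewrite !mem_filter => /andP[tr tD] ti.
  move=> xt Wt; apply: (hn t _ Wt); move: xt.
  case: eqP => [e|_ /andP[_ xt]]; first by rewrite -e (WkN t Wt) in skN.
  apply: chord_label_ends => //; move: ti; rewrite /i' eq_sym;
    case: ifP => // ikN _.
  by apply/negP => /eqP e; rewrite e (WkN t Wt) in ikN.
Qed.

End CutDiagram.
End Cut.

(** * The splitting formula *)

Lemma subword_iota n s t : (t <= n)%N ->
  subword (iota 1 n) s t = iota s.+1 (t - s).
Proof.
move=> le; rewrite /subword drop_iota take_iota add1n.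
by congr iota; apply/minn_idPl; apply: leq_sub2r.
Qed.

Lemma mx_entry_letter n k (a b : 'I_((size (iota 1 n)).+1)) X Y : (0 < k <=
  n)%N ->
  (X * letter_mx (iota 1 n) (Some k) * Y) a b
    = X a (inord k.-1) * Y (inord k) b.
Proof.
case/andP=> k0 kn.
have -> : letter_mx (iota 1 n) (Some k) = delta_mx (inord k.-1) (inord k).
  apply/matrixP => i j; rewrite !mxE -!val_eqE /= !inordK ?size_iota //;
    last by lia.
  congr (nat_of_bool _)%:R.
  have lj : (j < n.+1)%N by have := ltn_ord j;
    rewrite [X in (_ < X.+1)%N]size_iota.
  case: (j =P i.+1 :> nat) => [ej|nj] /=; last first.
    by apply/esym/negbTE/negP => /andP[/eqP ei /eqP ej]; apply: nj;
      rewrite ei ej prednK.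
  rewrite onthE (nth_map 0%N) ?size_iota; last by rewrite -ltnS -ej.
  rewrite nth_iota; last by rewrite -ltnS -ej.
  rewrite ej; apply/eqP/andP => [[e]|[/eqP e _]]; last by rewrite e add1n prednK.
  by rewrite -e add1n /= eqxx.
rewrite -!mulmxE -(mul_delta_mx (0 : 'I_1)) mulmxA -colE -mulmxA -rowE.
by rewrite mxE big_ord1 !mxE.
Qed.

Lemma count_before_after x c s : c \in s ->
  x \in before c s -> x \in after c s -> (1 < count_mem x s)%N.
Proof.
move=> cs; rewrite -!has_pred1 !has_count {3}(cat_before_after cs) count_cat /=.
by move: (count_mem _ _) (count_mem _ _) => p q; lia.
Qed.

Lemma pred_split k n : (0 < k <= n)%N -> n.-1 = (k.-1 + (n - k))%N.
Proof. by lia. Qed.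

Section Splitting.
Variables (S : chord_diagram -> tangle_diagram) (n : nat) (D : chord_diagram).
Variables (c k : nat).
Hypotheses (HS : representatives S) (wfD : cd_wf D).
Hypothesis labelsD : perm_eq (cd_labels D) (iota 1 n.+1).
Hypothesis degD : cd_degree D = n.
Hypothesis hk : (0 < k <= n)%N.
Hypotheses (ck : c \in cd_code D k) (cN : c \in cd_code D n.+1).

Local Notation N := n.+1.
Local Notation I := (iota 1 n).
Local Notation entry v := (inord v : 'I_((size I).+1)).
Local Notation J := (chords_J D k).
Local Notation J' := (chords_notJ D c k).
Local Notation codek := (cd_code D k).
Local Notation codeN := (cd_code D n.+1).

Let entryE v : (v <= n)%N -> entry v = v :> nat.
Proof. by move=> le; rewrite inordK // size_iota. Qed.

Let mem_labels t : (t \in cd_labels D) = (0 < t <= N)%N.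
Proof. by rewrite (perm_mem labelsD) mem_iota add1n ltnS. Qed.

Let kD : k \in cd_labels D.
Proof. by rewrite mem_labels; case/andP: hk => -> /leqW. Qed.

Let ND : N \in cd_labels D.
Proof. by rewrite mem_labels leqnn. Qed.

Let kN : k != N.
Proof. by case/andP: hk => _ le; rewrite neq_ltn ltnS le. Qed.

Let uc : uniq (cd_chords D).
Proof. by case/and3P: wfD. Qed.

Let cD : c \in cd_chords D.
Proof. exact: mem_code_chords wfD _ _ kD ck. Qed.

Definition lower (t : nat) : bool := (0 < t < k)%N.
Definition upper (t : nat) : bool := (k < t <= n)%N.

Lemma mem_J x : (x \in J) =
  (x \in cd_chords D) && has (fun i => x \in cd_code D i) (iota 1 k.-1).
Proof. by rewrite mem_filter andbC. Qed.

Lemma lower_labels t : lower t -> t \in cd_labels D.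
Proof. by rewrite /lower mem_labels; case/andP: hk; lia. Qed.

Lemma mem_J_lower x t : lower t -> x \in cd_code D t -> x \in J.
Proof.
move=> lt xt; rewrite mem_J (mem_code_chords wfD (lower_labels lt) xt) /=.
by apply/hasP; exists t => //; rewrite mem_iota; move: lt; rewrite /lower; lia.
Qed.

Lemma J_lower x : x \in J -> exists2 t, lower t & x \in cd_code D t.
Proof.
rewrite mem_J => /andP[_ /hasP[t]]; rewrite mem_iota => lt xt; exists t => //.
by move: lt; rewrite /lower; lia.
Qed.

Lemma c_notin_J : c \notin J.
Proof.
apply/negP => /J_lower[t lt ct]; have [_ ends] := chord_ends wfD kD ND kN ck cN.
have := ends t (lower_labels lt) ct; move: lt hk; rewrite /lower.
by case/andP=> _ lt /andP[_ le] /orP[]/eqP e; move: lt;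
  rewrite e ?ltnn // ltnNge leqW.
Qed.

Local Notation word_inf :=
  (component_word N (before c codeN) ++ formal_inverse (component_word k (before
    c codek))).
Local Notation word_zero :=
  (component_word k (before c codek) ++ component_word N (after c codeN)).

Definition value_inf (y : nat -> int) : int :=
  chord_expansion D I y word_inf (entry 0) (entry k.-1).

Definition value_zero (y : nat -> int) : int :=
  chord_expansion D I y word_zero (entry k) (entry n).

Lemma before_sub x s : {subset before x s <= s}.
Proof. by move=> z; exact: mem_take. Qed.

Lemma after_sub x s : {subset after x s <= s}.
Proof. by move=> z; exact: mem_drop. Qed.

Let subW_inf : {subset subword I (entry 0) (entry k.-1) <= lower}.
Proof.
case/andP: hk => k0 kn t; have kn' := leq_trans (leq_pred k) kn.
by rewrite !entryE ?subword_iota // mem_iota unfold_in /lower; lia.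
Qed.

Let subW_zero : {subset subword I (entry k) (entry n) <= upper}.
Proof.
case/andP: hk => k0 kn t.
by rewrite !entryE ?subword_iota // mem_iota unfold_in /upper; lia.
Qed.

Let lower_k : lower k = false. Proof. by rewrite /lower ltnn andbF. Qed.
Let lower_N : lower N = false.
Proof. by case/andP: hk => _ le; rewrite /lower [(N < k)%N]ltnNge (leqW le). Qed.
Let upper_k : upper k = false. Proof. by rewrite /upper ltnn. Qed.
Let upper_N : upper N = false. Proof. by rewrite /upper ltnn andbF. Qed.

Local Notation region_inf := (region D k N lower (before c codek) (before c
  codeN)).
Local Notation region_zero := (region D k N upper (before c codek) (after c
  codeN)).
Local Notation inner_inf := (inner D k N lower (before c codek) (before c codeN)).
Local Notation inner_zero := (inner D k N upper (before c codek) (after c codeN)).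

Lemma region_word_inf : all region_inf (unzip1 word_inf).
Proof.
rewrite /unzip1 map_cat all_cat /formal_inverse map_rev all_rev /component_word.
rewrite -!map_comp !all_map; apply/andP; split; apply/allP => z hz /=.
  by rewrite /region /= hz eqxx /= orbT.
by rewrite /region /= hz eqxx.
Qed.

Lemma region_word_zero : all region_zero (unzip1 word_zero).
Proof.
rewrite /unzip1 map_cat all_cat /component_word.
rewrite -!map_comp !all_map; apply/andP; split; apply/allP => z hz /=.
  by rewrite /region /= hz eqxx.
by rewrite /region /= hz eqxx /= orbT.
Qed.

Lemma inner_inf_J h t : inner_inf h t -> h.1 \in J.
Proof. by case=> _ lt /chord_labelP[_ _ ht]; exact: mem_J_lower lt ht. Qed.

Lemma inner_zero_J' h t : inner_zero h t -> h.1 \in J'.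
Proof.
case: h => x i iht.
have [iD tD it xi xt] := inner_ends kD ND (@before_sub c _) (@after_sub c _) iht.
have [_ ends] := chord_ends wfD iD tD it xi xt; have [rh ut _] := iht.
rewrite mem_filter /= (mem_code_chords wfD iD xi) andbT; apply/andP; split.
  apply/negP => /eqP e; rewrite {x}e in xi xt ends rh iht.
  have [_ endsc] := chord_ends wfD kD ND kN ck cN.
  by case/orP: (endsc t tD xt) => /eqP e; rewrite e ?upper_k ?upper_N in ut.
apply/negP => /J_lower[r lr xr].
have rku : (k < r)%N || (r == k) -> False.
  by move: lr; rewrite /lower; case/andP=> _ lt /orP[|/eqP e];
    [rewrite ltnNge ltnW|rewrite e ltnn in lt].
case/orP: (ends r (lower_labels lr) xr) => /eqP e; last first.
  by apply: rku; rewrite e; case/andP: ut => ->.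
case/or3P: rh => /= [/andP[ik _]|/andP[/eqP iN _]|/and3P[/andP[ki _] _ _]].
- by apply: rku; rewrite e ik orbT.
- by move: lr; rewrite e iN lower_N.
- by apply: rku; rewrite e ki.
Qed.

Lemma value_inf_depends (p : pred nat) : (forall h t, inner_inf h t -> p h.1) ->
  depends_on p value_inf.
Proof.
move=> hp; apply: (chord_expansion_depends subW_inf _ region_word_inf).
  move=> h t rh et ut; have iht : inner_inf h t by [].
  apply/andP; split; first exact: hp iht.
  by have := region_chord_word kD ND (@before_sub c _) (@before_sub c _) iht.
by rewrite !entryE //; case/andP: hk => _; exact: leq_trans (leq_pred k).
Qed.

Lemma value_zero_depends (p : pred nat) : (forall h t, inner_zero h t -> p h.1) ->
  depends_on p value_zero.
Proof.
move=> hp; apply: (chord_expansion_depends subW_zero _ region_word_zero).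
  move=> h t rh et ut; have iht : inner_zero h t by [].
  apply/andP; split; first exact: hp iht.
  by have := region_chord_word kD ND (@before_sub c _) (@after_sub c _) iht.
by rewrite !entryE //; case/andP: hk.
Qed.

Lemma codeN_split : component_word N codeN
  = component_word N (before c codeN) ++ ((c, N), true) :: component_word N
    (after c codeN).
Proof. by rewrite {1}(cat_before_after cN) /component_word map_cat. Qed.

Lemma chord_label_c : chord_label D (c, N) = Some k.
Proof. by apply: chord_label_ends => //; rewrite eq_sym. Qed.

(** The part free of the variable of [c], which the difference in this variable
    annihilates. *)
Definition value_without (y : nat -> int) : int :=
  chord_expansion D I y (component_word N (before c codeN ++ after c codeN))
    (entry 0) (entry n).

(** A word with [K_k] brought by [c] is cut at that letter: what comes before it
    is read along [N] up to [c] and then back along [k], and what comes after it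
    is read along [k] up to [c] and then along the rest of [N]. *)
Lemma chord_expansion_split y :
  chord_expansion D I y (component_word N codeN) (entry 0) (entry n)
    = value_without y + y c * (value_inf y * value_zero y).
Proof.
rewrite codeN_split /value_without /value_inf /value_zero /chord_expansion.
rewrite expansion_cat expansion_cons expr0 mul1r chord_label_c.
have -> : chord_word D (c, N) = component_word k (before c codek).
  by rewrite /chord_word chord_label_c.
rewrite /component_word !map_cat -!/(component_word _ _) !expansion_cat.
rewrite mulrDl mul1r mulrDr mxE; congr (_ + _).
rewrite -scalerAl -scalerAr mxE; congr (_ * _).
by rewrite /conjugate_letter -!mulrA !mulrA -mulrA mx_entry_letter.
Qed.

Lemma value_without_depends : depends_on (predC1 c) value_without.
Proof.
pose W t := (0 < t <= n)%N.
pose good h := [&& h != (c, N), h.2 \in cd_labels D & h.1 \in cd_code D h.2].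
have Nk : N != k by rewrite eq_sym.
have [c1 ends] := chord_ends wfD ND kD Nk cN ck.
apply: (@chord_expansion_depends W _ _ _ _ D good).
- move=> t; rewrite !entryE ?subword_iota // mem_iota unfold_in /W.
  by rewrite subn0 add1n ltnS.
- case=> x i t /and3P[/= nh iD xi] et Wt.
  have [tD ti xt] := chord_labelP et.
  have goodt z : z \in cd_code D t -> good (z, t).
    move=> zt; rewrite /good /= zt tD !andbT xpair_eqE negb_and.
    apply/orP; right; apply/negP => /eqP e; move: Wt.
    by rewrite /W e ltnn andbF.
  apply/andP; split; last first.
    rewrite /chord_word et /component_word /unzip1 -map_comp all_map.
    by apply/allP => z /before_sub zt; exact: goodt.
  rewrite /=; apply/negP => /eqP e; rewrite {x}e in nh xi xt et ti.
  case/orP: (ends i iD xi) => /eqP ei; first by rewrite ei eqxx in nh.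
  case/orP: (ends t tD xt) => /eqP e; first by rewrite e /W ltnn andbF in Wt.
  by rewrite e ei /= eqxx in ti.
- rewrite /component_word /unzip1 -map_comp all_map; apply/allP => z zPQ.
  have zN : z \in codeN by move: zPQ;
    rewrite mem_cat => /orP[/before_sub|/after_sub].
  rewrite /= /good /= zN ND !andbT xpair_eqE eqxx andbT.
  apply/negP => /eqP e; move: zPQ c1; rewrite e => cPQ.
  rewrite (cat_before_after cN) count_cat /= eqxx => c1.
  move: cPQ; rewrite -has_pred1 has_count count_cat; move: c1.
  by rewrite addnCA add1n => -[->].
- by rewrite !entryE.
Qed.

Lemma filter_J : [seq x <- cd_chords D | x \in J] = J.
Proof. by apply: eq_in_filter => x xD /=; rewrite mem_J xD. Qed.

Lemma filter_J' : [seq x <- [seq x <- cd_chords D | x \notin J] | x != c] = J'.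
Proof. by rewrite -filter_predI. Qed.

Lemma size_chords : (size J + size J' = n.-1)%N.
Proof.
pose rest := [seq x <- cd_chords D | x \notin J].
have e1 : (size J + size rest = n)%N.
  rewrite -{1}filter_J !size_filter -degD; exact: count_predC.
have e2 : (size J' + 1 = size rest)%N.
  rewrite -filter_J' -/rest size_filter -(count_predC (predC1 c) rest).
  congr (_ + _)%N; rewrite (eq_count (a2 := pred1 c)); last by move=> x /=;
    rewrite negbK.
  by rewrite count_uniq_mem ?filter_uniq // mem_filter c_notin_J cD.
by rewrite -e1 -e2 addn1 addnS.
Qed.

Lemma difference_split y :
  difference (cd_chords D)
      (fun y => chord_expansion D I y (component_word N codeN) (entry 0) (entry
        n)) y
    = difference J value_inf y * difference J' value_zero y.
Proof.
rewrite (eq_difference (g := fun y => value_without y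
  + value_inf y * (y c * value_zero y))); last first.
  by move=> y' _; rewrite chord_expansion_split mulrCA.
rewrite differenceD (difference_independent _ value_without_depends cD) add0r.
have dJ : depends_on (mem J) value_inf.
  by apply: value_inf_depends => h t /inner_inf_J.
have dJ' : depends_on (mem J') value_zero.
  by apply: value_zero_depends => h t /inner_zero_J'.
rewrite (differenceM (p := mem J)) //; last first.
  move=> y1 y2 e; congr (_ * _); first by apply: e; rewrite /= c_notin_J.
  apply: dJ' => z zJ'; apply: e; move: (zJ' : z \in J').
  by rewrite mem_filter => /andP[/andP[_ zJ] _].
rewrite filter_J; congr (_ * _).
rewrite (@differenceM _ (pred1 c) _ (fun y => y c) value_zero); first last.
- apply: depends_onW dJ' => z zJ'; move: (zJ' : z \in J').
  by rewrite mem_filter => /andP[/andP[]].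
- by move=> y1 y2 e; apply: e; rewrite /= eqxx.
have -> : filter (pred1 c) (filter (predC (mem J)) (cd_chords D)) = [:: c].
  by rewrite filter_pred1_uniq ?filter_uniq // mem_filter /= c_notin_J.
rewrite /= /update eqxx subr0 mul1r; congr (difference _ _ _).
by rewrite -filter_J'.
Qed.

Lemma notin_J_ne x : x \in J -> x != c.
Proof. by apply: contraTneq => ->; exact: c_notin_J. Qed.

(** One of the two endpoints of a chord of [J] is on a component below [k]. *)
Lemma J_ends x t : x \in J -> t \in cd_labels D -> lower t = false ->
  x \in cd_code D t -> (count_mem x (cd_code D t) = 1)%N /\
  forall r, r \in cd_labels D -> lower r = false -> x \in cd_code D r -> r = t.
Proof.
move=> /J_lower[l ll xl] tD nt xt; have lD := lower_labels ll.
have tl : t != l by apply/negP => /eqP e; rewrite e ll in nt.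
have [c1 ends] := chord_ends wfD tD lD tl xt xl; split=> // r rD nr xr.
by case/orP: (ends r rD xr) => /eqP // e; rewrite e ll in nr.
Qed.

Lemma count_split_code x (t : nat) : c \in cd_code D t -> x != c ->
  (count_mem x (cd_code D t)
   = count_mem x (before c (cd_code D t)) + count_mem x (after c (cd_code D
     t)))%N.
Proof.
move=> ct xc; rewrite {1}(cat_before_after ct) count_cat /=.
by rewrite eq_sym (negPf xc).
Qed.

(** The change of variables that absorbs the inversion of the letters on the
    reversed part of [k]; by multilinearity it multiplies the difference by the
    sign of the antisymmetry relation. *)
Definition reversal (x : nat) : int := (-1) ^+ (x \in before c codek).

Lemma prod_reversal :
  \prod_(x <- J) reversal x = (-1) ^+ count (mem J) (before c codek).
Proof.
have -> : \prod_(x <- J) reversal x = (-1) ^+ count (mem (before c codek)) J.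
  elim: J => [|x s IH]; first by rewrite big_nil.
  by rewrite big_cons IH /= exprD.
rewrite -!size_filter; congr (_ ^+ _); apply: perm_size; apply: uniq_perm.
- exact/filter_uniq/filter_uniq.
- apply: count_mem_uniq => x; rewrite count_filter mem_filter /=.
  case xJ: (x \in J); last first.
    rewrite (eq_count (a2 := pred0)) ?count_pred0 // => z /=.
    by case: eqP => // ->; rewrite xJ.
  rewrite (eq_count (a2 := pred1 x)); last first.
    by move=> z /=; case: eqP => // ->; rewrite xJ.
  case: (boolP (x \in _)) => [xb|nb]; last exact/count_memPn.
  have [c1 _] := J_ends xJ kD lower_k (before_sub xb).
  move: c1; rewrite (count_split_code ck (notin_J_ne xJ)).
  by move: xb; rewrite -has_pred1 has_count; case: (count_mem _ _) => //= -[|p].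
by move=> x; rewrite [LHS]mem_filter [RHS]mem_filter /= andbC.
Qed.

(** Either some chord of [J] has an endpoint that is removed, and both sides
    vanish since the expansion ignores it, or cutting gives a chord diagram whose
    expansion is the same up to [reversal]. *)
Lemma factor_inf_difference : size J = k.-1 ->
  factor_inf S D c k N = difference J value_inf (fun=> 0).
Proof.
move=> sizeJ; have [k0 kn] := andP hk.
have rem0 x : x \in J -> removed D k N lower (before c codek) (before c codeN)
  x ->
  difference J value_inf (fun=> 0) = 0.
  move=> xJ rx; apply: difference_independent xJ.
  apply: value_inf_depends => h t iht.
  exact: (removed_inner wfD kD ND kN lower_k lower_N (@before_sub c _)
    (@before_sub c _) rx iht).
rewrite /factor_inf; case: ifPn => [/hasP[x xa xJ]|/hasPn nhas].
  apply/esym/(rem0 x xJ); move: xa; rewrite mem_cat => /orP[xa|xa].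
    apply: Or31; split; first exact: after_sub xa.
    by move=> xb; exact: count_before_after xb xa.
  apply: Or32; split; first exact: after_sub xa.
  by move=> xb; exact: count_before_after xb xa.
rewrite /interval_weight /cd_degree /= sizeJ add1n prednK // eqxx /=.
case: ifPn => [_|/allPn[i]]; last first.
  rewrite mem_filter => /andP[iN iD]; rewrite negb_imply => /andP[ne nik].
  rewrite mulr0; have ik : i == k = false.
    by apply/negP => /eqP e; move: nik; rewrite e k0 leqnn.
  move: ne; rewrite /= ik -has_filter => /hasP[x xi xJ].
  apply/esym/(rem0 x xJ)/Or33; exists i; split=> //;
    first by rewrite ik (negPf iN).
  apply/negP => /andP[i0 lik]; move: nik; rewrite i0 ltnW //.
have uJ : uniq J by exact: filter_uniq.
case: eqP => [e1|ne1].
  have J0 : J = [::] by apply/eqP; rewrite -size_eq0 sizeJ -e1.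
  rewrite J0 (eq_count (a2 := pred0)) // count_pred0 expr0 mul1r /=.
  rewrite /value_inf -e1 /=; exact/esym/expansion_diag.
have newE x : x \in J -> count_mem x (before c codeN ++ rev (before c codek))
    = (count_mem x codek + count_mem x codeN)%N.
  move=> xJ; rewrite count_cat count_rev addnC.
  rewrite (count_split_code ck (notin_J_ne xJ)) (count_split_code cN (notin_J_ne
    xJ)).
  have na z : z \in after c codek ++ after c codeN -> z != x.
    by move=> hz; apply: contraNneq (nhas _ hz) => ->.
  have -> : count_mem x (after c codek) = 0%N.
    by apply/count_memPn/negP => h; move: (na x);
      rewrite mem_cat h eqxx => /(_ isT).
  have -> : count_mem x (after c codeN) = 0%N.
    by apply/count_memPn/negP => h; move: (na x);
      rewrite mem_cat h orbT eqxx => /(_ isT).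
  by rewrite !addn0.
have hs : (k == k) && (N == N) || (k == N) && (N == k) by rewrite !eqxx.
have subJ : {subset J <= cd_chords D} by move=> x; rewrite mem_filter => /andP[].
have wf' : cd_wf (split_inf D c k N) := wf_cut wfD kD ND kN hs uJ subJ newE.
have subI : subword I (entry 0) (entry k.-1) = iota 1 (k - 1).
  by rewrite !entryE ?subword_iota ?subn0 ?subn1 // (leq_trans (leq_pred k)).
have le0 : (entry 0 <= entry k.-1)%N.
  by rewrite !entryE // (leq_trans (leq_pred k)).
rewrite -subI (weight_difference HS wf') ?iota_uniq //; first last.
- by rewrite !entryE ?subn0 // (leq_trans (leq_pred k)).
- rewrite subI mem_iota; apply/negP => /andP[_].
  by rewrite subn1 add1n prednK // ltnn.
- by rewrite mem_filter kN kD.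
rewrite -prod_reversal -difference_scale //; last first.
  rewrite sizeJ; have := poly_le_chord_expansion (split_inf D c k N)
    (component_word k (cd_code (split_inf D c k N) k)) le0.
  by rewrite !entryE ?subn0 // (leq_trans (leq_pred k)).
apply: eq_difference => y _; rewrite /value_inf.
have ey x : y x = (-1) ^+ (true && (x \in before c codek)) * (reversal x * y x).
  by rewrite mulrA /reversal /= -signr_addb addbb mul1r.
have newU : {subset before c codek <= before c codeN ++ rev (before c codek)}.
  by move=> x xb; rewrite mem_cat mem_rev xb orbT.
have newV : {subset before c codeN <= before c codeN ++ rev (before c codek)}.
  by move=> x xb; rewrite mem_cat xb.
have [_ _ ->] := chord_expansion_cut wfD kD ND kN lower_k lower_N
  (@before_sub c _) (@before_sub c _) subW_inf hs inner_inf_J uJ subJ newE newU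
    newV ey
  region_word_inf.
  rewrite transport_cat transport_inverse !transport_component !eqxx orbT /=.
  congr (chord_expansion _ _ _ _ _ _);
    rewrite eqxx filter_cat /component_word map_cat.
  have -> : N == k = false by rewrite eq_sym (negPf kN).
  by rewrite /formal_inverse filter_rev -!map_rev -!map_comp.
by rewrite /window !leqnn.
Qed.

Lemma factor_zero_difference : size J' = (n - k)%N ->
  factor_zero S D c k N = difference J' value_zero (fun=> 0).
Proof.
move=> sizeJ'; have [k0 kn] := andP hk.
have rem0 x : x \in J' -> removed D k N upper (before c codek) (after c codeN)
  x ->
  difference J' value_zero (fun=> 0) = 0.
  move=> xJ rx; apply: difference_independent xJ.
  apply: value_zero_depends => h t iht.
  exact: (removed_inner wfD kD ND kN upper_k upper_N (@before_sub c _)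
    (@after_sub c _) rx iht).
rewrite /factor_zero; case: ifPn => [/hasP[x xa xJ]|/hasPn nhas].
  apply/esym/(rem0 x xJ); move: xa; rewrite mem_cat => /orP[xa|xa].
    apply: Or31; split; first exact: after_sub xa.
    by move=> xb; exact: count_before_after xb xa.
  apply: Or32; split; first exact: before_sub xa.
  by move=> xb; exact: count_before_after xa xb.
rewrite /interval_weight /cd_degree /= sizeJ' addSn subnKC // eqxx /=.
have uJ' : uniq J' by exact: filter_uniq.
have sup : supported k.+1 N (split_zero D c k N).
  apply/allP => i; rewrite mem_filter => /andP[ik iD]; apply/implyP => ne.
  move: (iD); rewrite mem_labels => /andP[i0 ->];
    rewrite andbT ltn_neqAle eq_sym ik /=.
  rewrite leqNgt; apply/negP => lik; move: ne; rewrite /= -has_filter => /hasP[x].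
  have iN : i == N = false by apply/negbTE; rewrite neq_ltn (ltn_trans lik).
  rewrite iN => xi; rewrite mem_filter => /andP[/andP[_ /negP nJ] _]; apply: nJ.
  by apply: (@mem_J_lower _ i) => //; rewrite /lower i0 lik.
rewrite sup; case: eqP => [[e1]|ne1].
  have -> : J' = [::] by apply/eqP; rewrite -size_eq0 sizeJ' -e1 subnn.
  rewrite /= /value_zero -e1; exact/esym/expansion_diag.
have notc x : x \in J' -> x != c.
  by rewrite mem_filter => /andP[/andP[]].
have newE x : x \in J' -> count_mem x (before c codek ++ after c codeN)
    = (count_mem x codek + count_mem x codeN)%N.
  move=> xJ; rewrite count_cat.
  rewrite (count_split_code ck (notc x xJ)) (count_split_code cN (notc x xJ)).
  have na z : z \in after c codek ++ before c codeN -> z != x.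
    by move=> hz; apply: contraNneq (nhas _ hz) => ->.
  have -> : count_mem x (after c codek) = 0%N.
    by apply/count_memPn/negP => h; move: (na x);
      rewrite mem_cat h eqxx => /(_ isT).
  have -> : count_mem x (before c codeN) = 0%N.
    by apply/count_memPn/negP => h; move: (na x);
      rewrite mem_cat h orbT eqxx => /(_ isT).
  by rewrite addn0.
have hs : (N == k) && (k == N) || (N == N) && (k == k) by rewrite !eqxx orbT.
have subJ' : {subset J' <= cd_chords D} by move=> x;
  rewrite mem_filter => /andP[].
have wf' : cd_wf (split_zero D c k N) := wf_cut wfD kD ND kN hs uJ' subJ' newE.
have le0 : (entry k <= entry n)%N by rewrite !entryE.
have subI : subword I (entry k) (entry n) = iota k.+1 (N - k.+1).
  by rewrite !entryE // subword_iota // subSS.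
rewrite -subI (weight_difference HS wf') ?iota_uniq //; first last.
- by rewrite !entryE.
- rewrite subI mem_iota subSS addSn subnKC // ltnn andbF //.
- by rewrite mem_filter eq_sym kN ND.
apply: eq_difference => y _; rewrite /value_zero.
have ey x : y x = (-1) ^+ (false && (x \in before c codek)) * y x by rewrite
  mul1r.
have newU : {subset before c codek <= before c codek ++ after c codeN}.
  by move=> x xb; rewrite mem_cat xb.
have newV : {subset after c codeN <= before c codek ++ after c codeN}.
  by move=> x xb; rewrite mem_cat xb orbT.
have [_ _ ->] := chord_expansion_cut wfD kD ND kN upper_k upper_N
  (@before_sub c _) (@after_sub c _) subW_zero hs inner_zero_J' uJ' subJ' newE
    newU newV ey
  region_word_zero.
  rewrite transport_cat !transport_component !eqxx orbT /=.
  by congr (chord_expansion _ _ _ _ _ _);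
    rewrite eqxx filter_cat /component_word map_cat.
by rewrite /window !leqnn.
Qed.

Lemma interval_weight_difference :
  interval_weight S 1 N D
    = difference J value_inf (fun=> 0) * difference J' value_zero (fun=> 0).
Proof.
have n0 : (0 < n)%N by case/andP: hk; exact: leq_trans.
rewrite -difference_split /interval_weight degD add1n eqxx /=.
have -> : supported 1 N D.
  by apply/allP => i; rewrite mem_labels => ->; rewrite implybT.
rewrite eqSS eq_sym (gtn_eqF n0).
have subI : subword I (entry 0) (entry n) = iota 1 (N - 1).
  by rewrite !entryE // subword_iota // subn0 subn1.
rewrite -subI (weight_difference HS wfD) ?iota_uniq //; first by rewrite !entryE.
  by rewrite subI mem_iota subn1 add1n /= ltnn.
by rewrite degD !entryE // subn0.
Qed.

(** When the numbers of chords do not match the degrees, one of the differences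
    is taken in too many variables. *)
Lemma splitting :
  interval_weight S 1 N D = factor_inf S D c k N * factor_zero S D c k N.
Proof.
have [k0 kn] := andP hk; have sz := size_chords.
rewrite interval_weight_difference.
have [eJ|neJ] := eqVneq (size J) k.-1.
  have eJ' : size J' = (n - k)%N.
    by apply: (@addnI (size J)); rewrite sz eJ (pred_split hk).
  by rewrite factor_inf_difference // factor_zero_difference.
have -> : factor_inf S D c k N = 0.
  rewrite /factor_inf; case: ifP => // _; rewrite /interval_weight /cd_degree /=.
  by rewrite -[in X in _ == X](prednK k0) add1n eqSS (negPf neJ) mulr0.
rewrite mul0r; have uJ : uniq J by exact: filter_uniq.
have uJ' : uniq J' by exact: filter_uniq.
have le0 : (entry 0 <= entry k.-1)%N.
  by rewrite !entryE // (leq_trans (leq_pred k)).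
have le1 : (entry k <= entry n)%N by rewrite !entryE.
move: neJ; rewrite neq_ltn => /orP[lt|lt]; last first.
  rewrite (@difference_degree _ k.-1 value_inf) ?mul0r //.
  have := poly_le_chord_expansion D word_inf le0.
  by rewrite !entryE ?subn0 // (leq_trans (leq_pred k)).
rewrite (@difference_degree _ (n - k) value_zero) ?mulr0 //.
  by rewrite -(ltn_add2l k.-1) -(pred_split hk) -sz ltn_add2r.
have := poly_le_chord_expansion D word_zero le1.
by rewrite !entryE.
Qed.

Lemma factor_inf_first : k = 1%N -> factor_inf S D c k N = 1.
Proof.
move=> k1; have J0 : J = [::].
  apply/eqP; rewrite -size_eq0 size_filter k1 /= (eq_count (a2 := pred0))
    ?count_pred0 //.
rewrite factor_inf_difference ?J0 ?k1 //=.
by rewrite /value_inf k1 /=; exact: expansion_diag.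
Qed.

Lemma splitting_last : k = n -> interval_weight S 1 N D = factor_inf S D c k N.
Proof.
move=> kn; have k0 : (0 < k)%N by case/andP: hk.
rewrite splitting; have [eJ|neJ] := eqVneq (size J) k.-1.
  have eJ' : size J' = 0%N.
    by apply: (@addnI (size J)); rewrite size_chords eJ addn0 kn.
  have J'0 : J' = [::] by apply/eqP; rewrite -size_eq0 eJ'.
  rewrite factor_zero_difference ?J'0 /=; last by rewrite -kn subnn.
  have -> : value_zero (fun=> 0) = 1; last by rewrite mulr1.
  rewrite /value_zero; have -> : entry k = entry n by rewrite kn.
  exact: expansion_diag.
have -> : factor_inf S D c k N = 0; last by rewrite mul0r.
rewrite /factor_inf; case: ifP => // _; rewrite /interval_weight /cd_degree /=.
by rewrite -[in X in _ == X](prednK k0) add1n eqSS (negPf neJ) mulr0.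
Qed.

End Splitting.

(** * A single chord *)

Lemma weight_single_chord S D c i j : representatives S -> cd_wf D ->
  cd_chords D = [:: c] -> i \in cd_labels D -> j \in cd_labels D -> i != j ->
  c \in cd_code D i -> c \in cd_code D j -> weight S [:: i] j D = 1.
Proof.
move=> HS wfD chD iD jD ij ci cj.
have [cnti _] := chord_ends wfD iD jD ij ci cj.
have ji : j != i by rewrite eq_sym.
have [cntj _] := chord_ends wfD jD iD ji cj ci.
have code1 t : t \in cd_labels D -> count_mem c (cd_code D t) = 1%N ->
    cd_code D t = [:: c].
  move=> tD; have : all (pred1 c) (cd_code D t).
    by apply/allP => x /(mem_code_chords wfD tD); rewrite chD inE.
  by move/all_pred1P => ->; rewrite count_nseq /= eqxx mul1n => ->.
have lab : chord_label D (c, j) = Some i by apply: chord_label_ends.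
have uI : uniq [:: i] by [].
have := @weight_difference S D [:: i] j (inord 0) (inord 1) HS wfD uI jD.
rewrite !inordK //= /cd_degree chD inE ji => -> //.
rewrite /= (code1 j jD cntj) /chord_expansion /component_word /= !expansion_seq1
  lab.
rewrite /chord_word lab (code1 i iD cnti) /before /= eqxx /=.
rewrite /conjugate_letter !expansion_nil !mul1r !mulr1 !mxE !inordK //= /update
  eqxx.
by rewrite eqxx mulr1 mul0r addr0 [_ + 1]addrC addrK.
Qed.

Local Close Scope ring_scope.

Theorem theorem2 (S : chord_diagram -> tangle_diagram)
    (HS : representatives S) :
  (forall (n : nat) (D : chord_diagram) (c k : nat),
     1 <= n ->
     cd_wf D ->
     perm_eq (cd_labels D) (iota 1 n.+1) ->
     cd_degree D = n ->
     1 <= k <= n ->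
     c \in cd_chords D ->
     c \in cd_code D k ->
     c \in cd_code D n.+1 ->
     [/\ interval_weight S 1 n.+1 D
           = (factor_inf S D c k n.+1 * factor_zero S D c k n.+1)%R,
         k = 1 -> interval_weight S 1 n.+1 D = factor_zero S D c k n.+1
       & k = n -> interval_weight S 1 n.+1 D = factor_inf S D c k n.+1])
  /\ (forall (D : chord_diagram) (c i j : nat),
        cd_wf D -> cd_chords D = [:: c] ->
        i \in cd_labels D -> j \in cd_labels D -> i != j ->
        c \in cd_code D i -> c \in cd_code D j ->
        weight S [:: i] j D = 1%R).
Proof.
split=> [n D c k n1 wfD labelsD degD hk cD ck cN|]; last first.
  by move=> D c i j; exact: weight_single_chord.
split; first exact: splitting.
  by move=> k1; rewrite (splitting HS wfD labelsD degD hk ck cN)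
    factor_inf_first ?mul1r.
exact: splitting_last.
Qed.
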